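(* Let $\Omega\subset\mathbb{R}^N$ be an open set with $N\ge 5$ and let $g$ be a nonnegative measurable function on $\Omega$. If there exists a function $w\in L^1((0,\infty),r^3)$ such that $g(x)\le w(|x|)$ for all $x\in\Omega$, then $g$ is admissible.
   Context: $\mathcal{D}^{2,2}_0(\Omega)$ denotes the completion of $C_c^\infty(\Omega)$ with respect to the norm $\|\Delta u\|_{L^2(\Omega)}$ (for $N\ge 5$ it is a function space). A function $g$ on $\Omega$ is called admissible if there is a constant $C>0$ such that $$\int_\Omega g(x)u^2\,dx\le C\int_\Omega|\Delta u|^2\,dx\qquad\text{for all }u\in\mathcal{D}^{2,2}_0(\Omega).$$ $L^1((0,\infty),r^3)$ is the space of measurable functions $w$ on $(0,\infty)$ with $\int_0^\infty|w(r)|\,r^3\,dr<\infty$. *)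

(* Defs.v *)
From HB Require Import structures.
From mathcomp Require Import all_boot all_order all_algebra.
From mathcomp Require Import all_classical all_reals all_analysis.

Set Implicit Arguments.
Unset Strict Implicit.
Unset Printing Implicit Defensive.

Import Order.TTheory GRing.Theory Num.Theory.
Import numFieldNormedType.Exports.

Local Open Scope classical_set_scope.
Local Open Scope ring_scope.

Definition measure_row_display : measure_display -> measure_display.
Proof. exact. Qed.

(* The sigma-algebra generated by the coordinates; for [T = measurableTypeR R]
   this is the Borel sigma-algebra of ['rV[R]_n]. *)
Section measurable_row.
Context {d} {T : measurableType d} (n : nat).

Let coors : 'I_n -> 'rV[T]_n -> T := fun i x => x ord0 i.

Let row_set0 : g_sigma_preimage coors set0.
Proof. exact: sigma_algebra0. Qed.

Let row_setC A : g_sigma_preimage coors A -> g_sigma_preimage coors (~` A).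
Proof. exact: sigma_algebraC. Qed.

Let row_bigcup (F : _^nat) : (forall i, g_sigma_preimage coors (F i)) ->
  g_sigma_preimage coors (\bigcup_i (F i)).
Proof. exact: sigma_algebra_bigcup. Qed.

HB.instance Definition _ := @isMeasurable.Build (measure_row_display d)
  'rV[T]_n (g_sigma_preimage coors) row_set0 row_setC row_bigcup.

End measurable_row.

Section measurable_row_theory.
Context d (T : measurableType d).

Lemma measurable_coord n (i : 'I_n) :
  measurable_fun [set: 'rV[T]_n] (fun x : 'rV[T]_n => x ord0 i).
Proof.
move=> _ Y mY; rewrite setTI; apply: sub_sigma_algebra => /=.
rewrite -bigcup_seq/=; exists i => /=; first by rewrite mem_index_enum.
by exists Y => //; rewrite setTI.
Qed.

Lemma measurable_fun_rowP d1 (T1 : measurableType d1) n (f : T1 -> 'rV[T]_n) :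
  measurable_fun [set: T1] f <->
  forall i, measurable_fun [set: T1] (fun x => f x ord0 i).
Proof.
split=> [mf i|mf].
  exact: (measurableT_comp (@measurable_coord n i) mf).
have E : g_sigma_preimage (fun i => (fun x : 'rV[T]_n => x ord0 i) \o f)
    `<=` measurable.
  apply: smallest_sub; first exact: sigma_algebra_measurable.
  case: n => [|n] in f mf *; first by rewrite big_ord0.
  rewrite -bigcup_mkord_ord; apply: bigcup_sub => i Ii.
  by move=> A [B mB <-]; exact: mf.
rewrite g_sigma_preimage_comp in E.
by move=> _ A mA; apply: E; exists A.
Qed.

Definition cons_row n (p : T * 'rV[T]_n) : 'rV[T]_n.+1 :=
  row_mx (const_mx p.1 : 'rV_1) p.2.

Definition uncons_row n (x : 'rV[T]_n.+1) : T * 'rV[T]_n :=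
  (x ord0 ord0, \row_j x ord0 (lift ord0 j)).

Lemma cons_row0 n (p : T * 'rV[T]_n) : cons_row p ord0 ord0 = p.1.
Proof.
have := row_mxEl (const_mx p.1 : 'rV_1) p.2 ord0 ord0.
by rewrite [RHS]mxE => <-; congr (fun_of_matrix _ _ _); exact: val_inj.
Qed.

Lemma cons_rowS n (p : T * 'rV[T]_n) j :
  cons_row p ord0 (lift ord0 j) = p.2 ord0 j.
Proof.
have <- := row_mxEr (const_mx p.1 : 'rV_1) p.2 ord0 j.
by congr (fun_of_matrix _ _ _); exact: val_inj.
Qed.

Lemma cons_rowK n : cancel (@cons_row n) (@uncons_row n).
Proof.
move=> [a x]; rewrite /uncons_row cons_row0; congr pair.
by apply/rowP => j; rewrite mxE cons_rowS.
Qed.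

Lemma measurable_cons_row n :
  measurable_fun [set: T * 'rV[T]_n] (@cons_row n).
Proof.
apply/measurable_fun_rowP => i; case: (unliftP ord0 i) => [j|] ->.
  under eq_fun do rewrite cons_rowS.
  exact: (measurableT_comp (@measurable_coord n j) measurable_snd).
by under eq_fun do rewrite cons_row0; exact: measurable_fst.
Qed.

Lemma measurable_uncons_row n :
  measurable_fun [set: 'rV[T]_n.+1] (@uncons_row n).
Proof.
apply: measurable_fun_pair; first exact: measurable_coord.
apply/measurable_fun_rowP => i.
by under eq_fun do rewrite mxE; exact: measurable_coord.
Qed.

End measurable_row_theory.

Section cons_measure.
Local Open Scope ereal_scope.
Context d (T : measurableType d) (R : realType) (n : nat).
Variable m1 : {sigma_finite_measure set T -> \bar R}.
Variable m2 : {sigma_finite_measure set 'rV[T]_n -> \bar R}.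

Definition cons_measure : set 'rV[T]_n.+1 -> \bar R :=
  pushforward (m1 \x m2) (@cons_row _ T n).

Let cons_measure0 : cons_measure set0 = 0.
Proof. by rewrite /cons_measure /pushforward preimage_set0 measure0. Qed.

Let cons_measure_ge0 A : 0 <= cons_measure A.
Proof. by rewrite /cons_measure /pushforward; exact: measure_ge0. Qed.

Let cons_measure_sigma_additive : semi_sigma_additive cons_measure.
Proof.
move=> F mF tF mUF; rewrite /cons_measure /pushforward preimage_bigcup.
apply: measure_semi_sigma_additive.
- by move=> k; rewrite -[X in measurable X]setTI; exact: measurable_cons_row.
- apply/trivIsetP => /= i j _ _ ij; rewrite -preimage_setI.
  by move/trivIsetP : tF => /(_ _ _ _ _ ij) ->//; rewrite preimage_set0.
- rewrite -preimage_bigcup -[X in measurable X]setTI.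
  exact: measurable_cons_row.
Qed.

HB.instance Definition _ := isMeasure.Build _ _ _ cons_measure
  cons_measure0 cons_measure_ge0 cons_measure_sigma_additive.

Let cons_measure_sigma_finite : sigma_finite setT cons_measure.
Proof.
have /sigma_finiteP[F [TF ndF Foo]] := sigma_finiteT m1.
have /sigma_finiteP[G [TG ndG Goo]] := sigma_finiteT m2.
exists (fun k => @uncons_row _ T n @^-1` (F k `*` G k)).
  apply/esym; rewrite -subTset => x _.
  have [i _ Fi] : (\bigcup_k F k) (uncons_row x).1 by rewrite -TF.
  have [j _ Gj] : (\bigcup_k G k) (uncons_row x).2 by rewrite -TG.
  exists (maxn i j) => //; split.
  - by move: Fi; exact/subsetPset/ndF/leq_maxl.
  - by move: Gj; exact/subsetPset/ndG/leq_maxr.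
move=> k; have [mF Fk] := Foo k; have [mG Gk] := Goo k; split.
  rewrite -[X in measurable X]setTI.
  by apply: measurable_uncons_row => //; exact: measurableX.
rewrite /cons_measure /pushforward -comp_preimage.
rewrite (_ : _ \o _ = id); last by apply/funext => p /=; rewrite cons_rowK.
by rewrite preimage_id product_measure1E// lte_mul_pinfty// ge0_fin_numE.
Qed.

HB.instance Definition _ := Measure_isSigmaFinite.Build _ _ _ cons_measure
  cons_measure_sigma_finite.

End cons_measure.

(* The [n]-fold product of [m] with itself. *)
Fixpoint row_measure d (T : measurableType d) (R : realType)
    (m : {sigma_finite_measure set T -> \bar R}) (n : nat) :
    {sigma_finite_measure set 'rV[T]_n -> \bar R} :=
  if n is k.+1 then cons_measure m (row_measure m k)
  else \d_(const_mx point).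

Lemma row_measure_box d (T : measurableType d) (R : realType)
    (m : {sigma_finite_measure set T -> \bar R}) n (A : 'I_n -> set T) :
  (forall i, measurable (A i)) ->
  row_measure m n [set x : 'rV[T]_n | forall i, A i (x ord0 i)] =
  (\prod_(i < n) m (A i))%E.
Proof.
elim: n => [|n IH] in A *; move=> mA.
  rewrite big_ord0 /= diracE mem_set//= => -[]//.
rewrite big_ord_recl -(IH (fun i => A (lift ord0 i)))// /= /cons_measure.
rewrite /pushforward -product_measure1E//; last first.
  rewrite [X in measurable X](_ : _ = \bigcap_(i in [set: 'I_n])
    [set x : 'rV[T]_n | A (lift ord0 i) (x ord0 i)]); last first.
    by apply/seteqP; split=> x /= H i; [move=> _; exact: H|exact: H].
  apply: fin_bigcap_measurable => // i _.
  rewrite -[X in measurable X]setTI.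
  by apply: measurable_coord.
congr product_measure1; apply/seteqP; split=> p /=.
  move=> H; split => [|i]; first by rewrite -(cons_row0 p).
  by rewrite -cons_rowS.
move=> [H0 HS] i; case: (unliftP ord0 i) => [j|] ->.
  by rewrite cons_rowS.
by rewrite cons_row0.
Qed.

(* As for [completed_lebesgue_measure], the sigma-algebra is that of the
   Lebesgue measurable sets. *)
Definition lebesgue_rowType (R : realType) (n : nat) : measurableType _ :=
  caratheodory_type (row_measure (@lebesgue_measure R) n)^*%mu.

Definition lebesgue_row (R : realType) (n : nat) :
    set (lebesgue_rowType R n) -> \bar R :=
  @completed_measure_extension _ _ _ (row_measure (@lebesgue_measure R) n).

HB.instance Definition _ (R : realType) (n : nat) :=
  Measure.on (@lebesgue_row R n).

Arguments lebesgue_row : clear implicits.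

Definition lebesgue_lineType (R : realType) : measurableType _ :=
  caratheodory_type ((wlength (@idfun R))^*)%mu.

Section D22.
Context {R : realType} {N : nat}.
Implicit Types (f u Lu g : 'rV[R]_N -> R) (Omega : set 'rV[R]_N).

(* The library norm [`|x|] on ['rV[R]_N] is the sup norm. *)
Definition enorm (x : 'rV[R]_N) : R := Num.sqrt (\sum_i x ord0 i ^+ 2).

Definition partial (i : 'I_N) f : 'rV[R]_N -> R :=
  fun x => 'D_(delta_mx ord0 i) f x.

Definition partials (s : seq 'I_N) f : 'rV[R]_N -> R := foldr partial f s.

Definition laplacian f : 'rV[R]_N -> R :=
  fun x => \sum_i partial i (partial i f) x.

(* [derive] is total, so the existence of the partial derivatives of every
   order has to be required along with their continuity. *)
Definition smooth f : Prop := forall s : seq 'I_N,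
  continuous (partials s f) /\
  forall i x, derivable (partials s f) x (delta_mx ord0 i).

Definition supp f : set 'rV[R]_N := closure [set x | f x != 0].

Definition Cc_infty Omega : set ('rV[R]_N -> R) :=
  [set f | [/\ smooth f, compact (supp f) & supp f `<=` Omega]].

(* [D22_0 Omega u Lu]: the function [u] is the element of the completion of
   [Cc_infty Omega] for the norm [|| laplacian f ||_2] given by a sequence
   [phi], and [Lu] is its Laplacian.  The sequence [laplacian (phi k)] is Cauchy
   in [L^2] exactly when it has a limit [Lu] there, which is how the Laplacian
   extends to the completion; [u] is the limit of [phi k] in [L^1_loc], which
   exists and determines the element when [N >= 5]. *)
Definition D22_0 Omega u Lu : Prop :=
  [/\ measurable_fun (Omega : set (lebesgue_rowType R N)) u,
      measurable_fun (Omega : set (lebesgue_rowType R N)) Lu &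
      exists phi : nat -> 'rV[R]_N -> R,
      [/\ forall k, Cc_infty Omega (phi k),
          (\int[lebesgue_row R N]_(x in Omega)
              ((laplacian (phi k) x - Lu x) ^+ 2)%:E)%E @[k --> \oo] --> 0%E &
          forall K : set 'rV[R]_N, compact K -> K `<=` Omega ->
          (\int[lebesgue_row R N]_(x in K)
              `|phi k x - u x|%:E)%E @[k --> \oo] --> 0%E]].

Definition admissible Omega g : Prop :=
  exists2 C : R, 0 < C & forall u Lu, D22_0 Omega u Lu ->
  (\int[lebesgue_row R N]_(x in Omega) (g x * u x ^+ 2)%:E
   <= C%:E * \int[lebesgue_row R N]_(x in Omega) (Lu x ^+ 2)%:E)%E.

End D22.

(* Membership in [L^1((0,oo), r^3)]; the values of [w] outside [(0,oo)] are
   irrelevant. *)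
Definition L1_r3 (R : realType) (w : R -> R) : Prop :=
  measurable_fun (`]0, +oo[ : set (lebesgue_lineType R)) w /\
  (\int[@completed_lebesgue_measure R]_(r in `]0%R, +oo[)
      (`|w r| * r ^+ 3)%:E < +oo)%E.

(* Main.v *)
Require Import Defs.
From mathcomp Require Import all_boot all_order all_algebra.
From mathcomp Require Import all_classical all_reals all_analysis.
From mathcomp Require Import measurable_realfun.
From mathcomp Require Import ring lra.

(** Write E for the integral of the squared Laplacian of a smooth compactly
supported phi, and r for |x|.  The heart of the matter is a trace estimate on
spheres: the integral of phi^2 over the sphere of radius r is at most a constant
times E r^3.  Integrating it against |w(r)| dr gives
  int w(|x|) phi^2 dx <= C |w|_{L^1(r^3)} E,
and the general case follows by approximation.

The trace estimate is read as an estimate for the pushforward under x |-> |x| of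
the measure phi^2 |x|^-3 dx: this measure is at most a constant times E times the
Lebesgue measure, and it is enough to see this on intervals, that is, on
spherical shells.  For a shell a < |x| <= a + h,
take rho = |x|^2 + e and the vector field
  F = phi grad(phi) / rho + phi^2 m(sqrt rho) x / rho^2
where m increases from 1 to 2 across the shell (an arctangent step of width h).
Its divergence has integral zero [integral_partial0] and, when N >= 5, it is
bounded below pointwise by phi^2 |x|^2 m'(sqrt rho) / rho^(5/2) minus a quarter
of the squared Laplacian [divergence_lower_bound].  The first summand of F is the
one that proves Rellich's inequality, the second with m = 1 the one that proves
Hardy's; letting m vary adds the term in m', which is at least of order
phi^2 |x|^-3 / h on the shell.  Hence
  int_{a < |x| <= a + h} phi^2 |x|^-3 dx <= 10 pi h E   [shell_bound],
uniformly in the neighbourhood of the origin that is cut out.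

The outer Lebesgue measure being an infimum over covers by intervals, the
integral of phi^2 |x|^-3 over a measurable set M is at most 10 pi E times the
outer measure of any set that contains the radii of the points of M
[integral_le_outer_measure].  To use it for g and w, which are only Lebesgue
measurable, one slices g |x|^3 into layers, sends each superlevel set of g |x|^3
into the corresponding superlevel set of |w| r^3, and sums [integral_le_layers,
radial_domination].

For an element (u, Lu) of the completion, the bound for the approximating phi_k
passes to u on compact subsets of Omega away from the origin once g and u are
truncated, because then L^1 convergence controls the error
[integral_truncated_le]; an exhaustion and monotone convergence remove the
truncations [integral_le_exhaustion]. *)

Set Implicit Arguments.
Unset Strict Implicit.
Unset Printing Implicit Defensive.

Import Order.TTheory GRing.Theory Num.Theory.
Import numFieldNormedType.Exports.

Local Open Scope classical_set_scope.
Local Open Scope ring_scope.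

(** * Borel sets and continuous functions on row vectors *)

Lemma measurable_row_box (R : realType) n (A : 'I_n -> set (measurableTypeR R)) :
  (forall i, measurable (A i)) ->
  measurable [set x : 'rV[measurableTypeR R]_n | forall i, A i (x ord0 i)].
Proof.
move=> mA; rewrite [X in measurable X](_ : _ = \bigcap_(i in [set: 'I_n])
    [set x : 'rV[measurableTypeR R]_n | A i (x ord0 i)]); last first.
  by apply/seteqP; split=> x /= H i; [move=> _; exact: H|exact: H].
apply: fin_bigcap_measurable => // i _.
by rewrite -[X in measurable X]setTI; apply: measurable_coord.
Qed.

(** The sigma-algebra is generated by the coordinates; it contains the open sets
because boxes with rational centres and radii 1/(k+1) form a countable base. *)
Lemma open_measurable_row (R : realType) n (U : set 'rV[R]_n) :
  open U -> measurable (U : set 'rV[measurableTypeR R]_n).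
Proof.
move=> oU.
pose B (p : 'rV[rat]_n * nat) : set 'rV[measurableTypeR R]_n :=
  [set x | forall i, `|x ord0 i - ratr (p.1 ord0 i)| < p.2.+1%:R^-1].
have mB p : measurable (B p).
  have := @measurable_row_box R n
    (fun i => `](ratr (p.1 ord0 i) - p.2.+1%:R^-1), (ratr (p.1 ord0 i) + p.2.+1%:R^-1)[%classic)
    (fun i => measurable_itv _).
  congr measurable; apply/seteqP; split => x /= xB i; have := xB i.
    by rewrite in_itv/= ltr_distl.
  by rewrite in_itv/= ltr_distl.
have -> : U = \bigcup_(p in [set p | B p `<=` U]) B p.
  apply/seteqP; split => [x Ux|x [p pU /pU]//].
  have /nbhs_ballP[e /= e0 eU] := oU x Ux.
  have /ltr_add_invr[k] := e0. rewrite add0r => ke.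
  pose d : R := k.*2.+1.+1%:R^-1.
  have d0 : 0 < d by rewrite invr_gt0 ltr0n.
  have q_ i : exists q : rat, `|x ord0 i - ratr q| < d.
    have /rat_in_itvoo[q] : x ord0 i - d < x ord0 i + d.
      by rewrite ltrBlDr -addrA ltrDl addr_gt0.
    by rewrite in_itv/= => /andP[q1 q2]; exists q; rewrite ltr_distl; apply/andP; split; lra.
  have [q qP] := choice q_.
  exists ((\row_i q i), k.*2.+1) => /=; last by move=> i /=; rewrite mxE.
  move=> y /= yq; apply: eU; split => // i j; rewrite ord1.
  have := yq j; rewrite mxE => yj.
  rewrite /ball /=.
  rewrite (_ : _ - _ = (x ord0 j - ratr (q j)) - (y ord0 j - ratr (q j))); last by ring.
  apply: le_lt_trans (ler_normB _ _) _.
  apply: lt_trans ke.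
  have -> : k.+1%:R^-1 = d + d.
    rewrite /d; have -> : k.*2.+2%:R = k.+1%:R * 2 :> R by rewrite -doubleS -muln2 natrM.
    by rewrite invfM; move: (k.+1%:R^-1) => c; lra.
  exact: ltrD.
rewrite bigcup_mkcond; apply: countable_bigcupT_measurable => [|p].
  exact: countableP.
by case: ifP.
Qed.

Lemma closed_measurable_row (R : realType) n (F : set 'rV[R]_n) :
  closed F -> measurable (F : set 'rV[measurableTypeR R]_n).
Proof.
by move=> /closed_openC/open_measurable_row/measurableC; rewrite setCK.
Qed.

Lemma continuous_measurable_row (R : realType) n (f : 'rV[R]_n -> R) :
  continuous f -> measurable_fun [set: 'rV[measurableTypeR R]_n] f.
Proof.
move=> /continuousP cf.
apply: (measurability _ (RGenOpens.measurableE R)).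
move=> _ [_ [a [b ->] <-]]; rewrite setTI.
by apply: (open_measurable_row (cf _ _)); exact: interval_open.
Qed.

(** * The integral of a partial derivative *)

(** The fundamental theorem of calculus on an interval that contains the
support. *)
Lemma integral_derive_itv0 (R : realType) (G G' : R -> R) (M : R) :
  continuous G' -> (forall t : R, is_derive t 1 G (G' t)) ->
  (forall t, M < `|t| -> G t = 0 /\ G' t = 0) ->
  (\int[@lebesgue_measure R]_t (G' t)%:E = 0)%E.
Proof.
move=> cG' dG GM.
pose b := `|M| + 1.
have b0 : 0 < b by rewrite ltr_wpDl.
have Mb : M < b by rewrite ltr_pwDr// ler_norm.
have cG : continuous G.
  move=> t; apply: differentiable_continuous; apply/derivable1_diffP.
  by have [] := dG t.
transitivity (\int[@lebesgue_measure R]_(t in `[(- b)%R, b]) (G' t)%:E)%E.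
  rewrite [RHS]integral_mkcond; apply: eq_integral => t _.
  rewrite patchE; case: ifPn => //; rewrite notin_setE/= in_itv/= => tb.
  rewrite (GM t _).2//; apply: lt_le_trans Mb _.
  by rewrite leNgt; apply/negP => /ltW; rewrite ler_norml.
rewrite (@continuous_FTC2 _ G' G) //.
- by rewrite (GM b _).1 ?(GM (- b) _).1 ?subee// ?normrN gtr0_norm.
- by rewrite gtrN.
- exact: continuous_subspaceT.
- split.
  + by move=> t _; have [] := dG t.
  + exact/cvg_at_right_filter/cG.
  + exact/cvg_at_left_filter/cG.
- by move=> t _; rewrite derive1E; have [_ ->] := dG t.
Qed.

Section cons_row_topology.
Variables (R : realType) (n : nat).
Implicit Types (t s : R) (y : 'rV[R]_n).
Let cons_row := @cons_row _ (measurableTypeR R) n.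

(** Moving along a coordinate axis commutes with [cons_row], so that the product
structure of [row_measure] lets Fubini's theorem isolate one coordinate. *)
Lemma cons_row_addl t s y :
  cons_row (t + s, y) = cons_row (t, y) + s *: delta_mx ord0 ord0 :> 'rV[R]_n.+1.
Proof.
apply/rowP => i; rewrite [RHS]mxE [X in _ = _ + X]mxE [X in _ = _ + _ * X]mxE.
case: (unliftP ord0 i) => [j|] ->.
  by rewrite !(@cons_rowS _ (measurableTypeR R)) /= mulr0 addr0.
by rewrite !(@cons_row0 _ (measurableTypeR R)) /= mulr1.
Qed.

Lemma cons_row_addr t s y j :
  cons_row (t, y + s *: delta_mx ord0 j) =
  cons_row (t, y) + s *: delta_mx ord0 (lift ord0 j) :> 'rV[R]_n.+1.
Proof.
apply/rowP => i; rewrite [RHS]mxE [X in _ = _ + X]mxE [X in _ = _ + _ * X]mxE.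
case: (unliftP ord0 i) => [k|] ->.
  by rewrite !(@cons_rowS _ (measurableTypeR R)) /= !mxE (inj_eq (@lift_inj _ ord0)).
by rewrite !(@cons_row0 _ (measurableTypeR R)) /= mulr0 addr0.
Qed.

Lemma cons_row_continuousr t : continuous (fun y => cons_row (t, y) : 'rV[R]_n.+1).
Proof.
move=> y A /nbhs_ballP[e /= e0 eA]; apply/nbhs_ballP; exists e => //= z [_ yz].
apply: eA; split=> // i j; rewrite ord1; case: (unliftP ord0 j) => [k|] ->.
  by rewrite !(@cons_rowS _ (measurableTypeR R)); exact: yz.
by rewrite !(@cons_row0 _ (measurableTypeR R)); exact: ballxx.
Qed.

Lemma cons_row_continuousl y : continuous (fun t => cons_row (t, y) : 'rV[R]_n.+1).
Proof.
move=> t A /nbhs_ballP[e /= e0 eA]; apply/nbhs_ballP; exists e => //= z tz.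
apply: eA; split=> // i j; rewrite ord1; case: (unliftP ord0 j) => [k|] ->.
  by rewrite !(@cons_rowS _ (measurableTypeR R)); exact: ballxx.
by rewrite !(@cons_row0 _ (measurableTypeR R)); exact: tz.
Qed.

End cons_row_topology.

Section integral_partial.
Variable R : realType.

Lemma bounded_integrable_row n (f : 'rV[R]_n -> R) (M B : R) : continuous f ->
  (forall (x : 'rV[R]_n) i, M < `|x ord0 i| -> f x = 0) -> (forall x, `|f x| <= B) ->
  (row_measure (@lebesgue_measure R) n).-integrable setT (EFin \o f).
Proof.
move=> cf fM fB.
have mf := continuous_measurable_row cf.
pose D : set 'rV[measurableTypeR R]_n := [set x | forall i, `[- M, M]%classic (x ord0 i)].
have mD : measurable D.
  exact: (@measurable_row_box R n (fun=> `[- M, M]%classic) (fun=> measurable_itv _)).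
apply/integrableP; split; first exact/measurable_EFinP.
apply: (@le_lt_trans _ _ (\int[row_measure (@lebesgue_measure R) n]_(x in D) (cst B%:E) x)%E).
  rewrite [leRHS]integral_mkcond; apply: ge0_le_integral => //.
  - by apply: measurableT_comp => //; exact/measurable_EFinP.
  - by apply/(measurable_restrictT _ _).1 => //; exact: measurable_cst.
  - move=> x _; rewrite patchE; case: ifPn => [_|].
      by rewrite /= lee_fin.
    rewrite notin_setE /D/= => /existsNP[i]; rewrite in_itv/= -ler_norml => /negP.
    by rewrite -ltNge => /fM ->; rewrite normr0.
rewrite integral_cst//.
have DE := @row_measure_box _ _ R (@lebesgue_measure R) n (fun=> `[-M, M]%classic)
  (fun=> measurable_itv _).
rewrite [X in (_ * X)%E](etrans _ DE)//.
have [c ->] : exists c : R,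
    (\prod_(j < n) lebesgue_measure (`[(- M)%R, M]%classic : set R) = c%:E)%E.
  elim/big_ind : _ => [|_ _ [c ->] [c' ->]|j _]; [by exists 1|by exists (c * c')|].
  exists (fine (lebesgue_measure (`[- M, M]%classic : set R))).
  by rewrite fineK// lebesgue_measure_itv/=; case: ifPn.
by rewrite -EFinM ltry.
Qed.

(** Induction on the dimension: the derivative is either in the first coordinate,
which is integrated first, or in one of the others, which are integrated first
by the induction hypothesis.  The derivative is taken along lines so that the
one-variable rules apply to it. *)
Lemma integral_partial0 n (i : 'I_n) (F F' : 'rV[R]_n -> R) (M B : R) :
  continuous F' ->
  (forall (x : 'rV[R]_n) (t : R), is_derive t 1 (fun s : R => F (x + s *: delta_mx ord0 i))
    (F' (x + t *: delta_mx ord0 i))) ->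
  (forall (x : 'rV[R]_n) j, M < `|x ord0 j| -> F x = 0 /\ F' x = 0) ->
  (forall x, `|F' x| <= B) ->
  (\int[row_measure (@lebesgue_measure R) n]_x (F' x)%:E = 0)%E.
Proof.
elim: n => [|n IH] in i F F' *; first by case: i.
move=> cF' dF FM FB.
have iF : (row_measure (@lebesgue_measure R) n.+1).-integrable setT (EFin \o F').
  by apply: (@bounded_integrable_row _ _ M B) => // x j /FM[].
have mcons := @measurable_cons_row _ (measurableTypeR R) n.
have iFc : (@lebesgue_measure R \x row_measure (@lebesgue_measure R) n)%E.-integrable setT
    (fun p => (F' (cons_row p))%:E).
  move/integrableP : iF => [mF iF]; apply/integrableP; split.
    exact: (measurableT_comp mF mcons).
  apply: le_lt_trans iF; rewrite [leRHS]ge0_integral_pushforward//.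
  exact: measurableT_comp.
transitivity (\int[(@lebesgue_measure R \x row_measure (@lebesgue_measure R) n)%E]_p
    (F' (cons_row p))%:E)%E.
  have mF : measurable_fun [set: 'rV[measurableTypeR R]_n.+1] (EFin \o F').
    exact: measurable_int iF.
  exact: (integral_pushforward mcons mF iFc measurableT).
case: (unliftP ord0 i) => [j|] ei; rewrite {}ei in dF *.
- rewrite -integral12_prod_meas1//=.
  apply: integral0_eq => t _.
  rewrite /fubini_F/=.
  apply: (IH j (fun y => F (@cons_row _ (measurableTypeR R) n (t, y)))
    (fun y => F' (@cons_row _ (measurableTypeR R) n (t, y)))).
  + by move=> y; apply: continuous_comp; [exact: cons_row_continuousr|exact: cF'].
  + move=> y s /=; rewrite cons_row_addr; under eq_fun do rewrite cons_row_addr.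
    exact: dF.
  + by move=> y k yk; apply: (FM _ (lift ord0 k)); rewrite cons_rowS.
  + by move=> y; exact: FB.
- rewrite -integral21_prod_meas1//=.
  apply: integral0_eq => y _.
  rewrite /fubini_G/=.
  apply: (@integral_derive_itv0 _ (fun t => F (@cons_row _ (measurableTypeR R) n (t, y))) _ M).
  + by move=> t; apply: continuous_comp; [exact: cons_row_continuousl|exact: cF'].
  + move=> t; have := dF (@cons_row _ (measurableTypeR R) n (0 : R, y)) t.
    rewrite -cons_row_addl add0r; under eq_fun do rewrite -cons_row_addl add0r.
    done.
  + by move=> t yk; apply: (FM _ ord0); rewrite cons_row0.
Qed.

End integral_partial.

(** * The divergence of the test field *)

Lemma is_derive_line (R : realType) n (f : 'rV[R]_n -> R) (x v : 'rV[R]_n) (t : R) :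
  derivable f (x + t *: v) v ->
  is_derive t 1 (fun s => f (x + s *: v)) ('D_v f (x + t *: v)).
Proof.
move=> df.
have E : (fun h : R => h^-1 *: (((fun s => f (x + s *: v)) \o shift t) (h *: 1) -
                         (fun s => f (x + s *: v)) t)) =
   (fun h : R => h^-1 *: ((f \o shift (x + t *: v)) (h *: v) - f (x + t *: v))).
  apply/funext => h /=; congr (_ *: (f _ - _)).
  by rewrite scalerDl addrCA /GRing.scale/= mulr1.
constructor; first by rewrite /derivable E.
by rewrite /derive E.
Qed.

(** Along a line in the direction of the i-th axis, [f] stands for phi, [f1] for
its i-th partial derivative, [c] for the i-th coordinate and [r] for |x|^2 + e;
the derivative of the i-th component of the test field is computed. *)
Lemma is_derive_field (R : realType) (f f1 c r m : R -> R) (t b m1 : R) :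
  0 < r t -> is_derive t 1 f (f1 t) -> is_derive t 1 f1 b ->
  is_derive t 1 c 1 -> is_derive t 1 r (2 * c t) ->
  is_derive (Num.sqrt (r t)) 1 m m1 ->
  is_derive t 1
    (fun s => f s * f1 s / r s + f s ^+ 2 * c s * m (Num.sqrt (r s)) / r s ^+ 2)
    (f1 t ^+ 2 / r t + f t * b / r t
     + 2 * f t * f1 t * c t * (m (Num.sqrt (r t)) - 1) / r t ^+ 2
     + f t ^+ 2 * m (Num.sqrt (r t)) / r t ^+ 2
     + f t ^+ 2 * c t ^+ 2 * m1 / (Num.sqrt (r t) * r t ^+ 2)
     - 4 * f t ^+ 2 * c t ^+ 2 * m (Num.sqrt (r t)) / r t ^+ 3).
Proof.
move=> r0 df df1 dc dr dm.
have dq : is_derive t 1 (fun s => (r s)^-1) (- (r t) ^- 2 *: (2 * c t)).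
  by apply: is_deriveV => //; rewrite gt_eqF.
have dms : is_derive t 1 (m \o (Num.sqrt \o r)) (m1 * ((2 * Num.sqrt (r t))^-1 * (2 * c t))).
  have ds := @is_derive1_comp _ Num.sqrt r t _ _ (is_derive1_sqrt r0) dr.
  exact: (@is_derive1_comp _ m (Num.sqrt \o r) t _ _ dm ds).
have d1 := is_deriveM (is_deriveM df df1) dq.
have d2 := is_deriveM (is_deriveM (is_deriveM (is_deriveM df df) dc) dms) (is_deriveM dq dq).
have d := is_deriveD d1 d2.
have E : f * f1 * (fun s => (r s)^-1) + f * f * c * (m \o (Num.sqrt \o r)) *
    ((fun s => (r s)^-1) * (fun s => (r s)^-1)) =
  (fun s => f s * f1 s / r s + f s ^+ 2 * c s * m (Num.sqrt (r s)) / r s ^+ 2).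
  by apply/funext => s; rewrite !fctE /= -exprVn !expr2 !mulrA.
rewrite -E.
apply: is_derive_eq d _.
have s0 : 0 < Num.sqrt (r t) by rewrite sqrtr_gt0.
rewrite /GRing.scale /= !mulrfctE /=.
set q := Num.sqrt (r t) in s0 *.
set M := m q.
by field; rewrite !gt_eqF.
Qed.

(** Here [c i], [f1 i], [f11 i] are the coordinates and the first and second
partial derivatives of phi at a point, and the right-hand side is the divergence
of the test field.  The dimension enters through the coefficient N m of f^2 / r^2:
it must exceed 4 m + (m - 1)^2, which is what the last term and the square
completed in the gradient cost, by at least 1, which pays for f L / r; and
5 m - 4 m - (m - 1)^2 >= 1 exactly when 1 <= m <= 2. *)
Lemma divergence_lower_bound (R : realType) (N : nat) (c f1 : 'I_N -> R)
    (f L r e m m1 q : R) : (5 <= N)%N -> 0 < e -> 0 < q ->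
  1 <= m <= 2 -> \sum_i c i ^+ 2 + e = r ->
  forall f11 : 'I_N -> R, \sum_i f11 i = L ->
  f ^+ 2 * (r - e) * m1 / (q * r ^+ 2) - 4^-1 * L ^+ 2 <=
  \sum_i (f1 i ^+ 2 / r + f * f11 i / r + 2 * f * f1 i * c i * (m - 1) / r ^+ 2
     + f ^+ 2 * m / r ^+ 2 + f ^+ 2 * c i ^+ 2 * m1 / (q * r ^+ 2)
     - 4 * f ^+ 2 * c i ^+ 2 * m / r ^+ 3).
Proof.
move=> N5 e0 q0 /andP[m_1 m_2] rE f11 LE.
have S0 : 0 <= \sum_i c i ^+ 2 by apply: sumr_ge0 => i _; exact: sqr_ge0.
have r0 : 0 < r by rewrite -rE ltr_wpDl.
have Sr : \sum_i c i ^+ 2 = r - e by rewrite -rE addrK.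
apply: (@le_trans _ _ (\sum_i (f11 i * (f / r) + (f ^+ 2 * m / r ^+ 2)
   + c i ^+ 2 * (f ^+ 2 * m1 / (q * r ^+ 2) - 4 * f ^+ 2 * m / r ^+ 3
   - (m - 1) ^+ 2 * f ^+ 2 / r ^+ 3)))); last first.
  apply: ler_sum => i _; rewrite -subr_ge0.
  (* Completing the square absorbs the cross term in [f * f1 i]. *)
  rewrite [leRHS](_ : _ = (f1 i + (m - 1) * f * c i / r) ^+ 2 / r).
    by rewrite divr_ge0// ?sqr_ge0// ltW.
  by field; rewrite !gt_eqF.
rewrite !big_split/= -!mulr_suml LE Sr sumr_const card_ord -mulr_natl.
have N5' : 5 <= N%:R :> R by rewrite ler_nat.
have H1 : 5 * (f ^+ 2 * m / r ^+ 2) <= N%:R * (f ^+ 2 * m / r ^+ 2).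
  apply: ler_wpM2r => //; apply: mulr_ge0; last by rewrite invr_ge0 exprn_ge0// ltW.
  by rewrite mulr_ge0 ?sqr_ge0//; lra.
have H2 : (r - e) / r <= 1 by rewrite ler_pdivrMr// mul1r; lra.
rewrite -subr_ge0.
(* With N = 5 the difference of the two sides is exactly this sum of nonnegative
   terms: 1 <= m <= 2 gives the second, |x|^2 <= r the third. *)
apply: (@le_trans _ _ ((f / r + L / 2) ^+ 2 + (f / r) ^+ 2 * ((m - 1) * (2 - m))
  + (1 - (r - e) / r) * ((f / r) ^+ 2 * (4 * m + (m - 1) ^+ 2)))).
  rewrite addr_ge0// ?addr_ge0// ?sqr_ge0//.
    by rewrite mulr_ge0 ?sqr_ge0// mulr_ge0//; lra.
  by rewrite mulr_ge0 ?subr_ge0// mulr_ge0 ?sqr_ge0// addr_ge0 ?sqr_ge0//; lra.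
rewrite -subr_ge0; move: H1; rewrite -subr_ge0 => H1; apply: (le_trans H1).
rewrite -subr_ge0 [leRHS](_ : _ = 0)//.
by field; rewrite !gt_eqF.
Qed.

(** * Smooth functions and their supports *)

Section continuity.
Context {R : realType} {T : topologicalType}.
Implicit Types f g : T -> R.

Lemma continuous_add f g : continuous f -> continuous g ->
  continuous (fun x => f x + g x).
Proof. by move=> cf cg x; apply: cvgD; [exact: cf|exact: cg]. Qed.

Lemma continuous_sub f g : continuous f -> continuous g ->
  continuous (fun x => f x - g x).
Proof. by move=> cf cg x; apply: cvgB; [exact: cf|exact: cg]. Qed.

Lemma continuous_mul f g : continuous f -> continuous g ->
  continuous (fun x => f x * g x).
Proof. by move=> cf cg x; apply: cvgM; [exact: cf|exact: cg]. Qed.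

Lemma continuous_inv f : (forall x, f x != 0) -> continuous f ->
  continuous (fun x => (f x)^-1).
Proof. by move=> f0 cf x; apply: cvgV => //; exact: cf. Qed.

Lemma continuous_exp f k : continuous f -> continuous (fun x => f x ^+ k).
Proof.
move=> cf x.
by apply: (@continuous_comp _ _ _ f (fun y => y ^+ k)); [exact: cf|exact: exprn_continuous].
Qed.

Lemma continuous_sqrt f : continuous f -> continuous (fun x => Num.sqrt (f x)).
Proof.
move=> cf x.
by apply: (@continuous_comp _ _ _ f Num.sqrt); [exact: cf|exact: sqrt_continuous].
Qed.

Lemma continuous_bigsum (I : finType) (h : I -> T -> R) :
  (forall i, continuous (h i)) -> continuous (fun x => \sum_i h i x).
Proof.
move=> ch; elim: (index_enum I) => [|i s IH].
  by under eq_fun do rewrite big_nil; move=> x; exact: cvg_cst.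
under eq_fun do rewrite big_cons.
exact: continuous_add.
Qed.

End continuity.

Section smooth_functions.
Variables (R : realType) (N : nat).
Implicit Types (f : 'rV[R]_N -> R) (x : 'rV[R]_N).

Lemma smooth_continuous f : smooth f -> continuous f.
Proof. by move=> sf; have [] := sf [::]. Qed.

Lemma smooth_partial f i : smooth f -> smooth (partial i f).
Proof.
move=> sf s; have := sf (rcons s i).
by rewrite /partials foldr_rcons.
Qed.

Lemma smooth_is_derive f i x (t : R) : smooth f ->
  is_derive t 1 (fun s : R => f (x + s *: delta_mx ord0 i))
    (partial i f (x + t *: delta_mx ord0 i)).
Proof. by move=> sf; apply: is_derive_line; have [_] := sf [::]; apply. Qed.

Lemma laplacian_continuous f : smooth f -> continuous (laplacian f).
Proof.
move=> sf; apply: continuous_bigsum => i.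
by apply: smooth_continuous; do 2 apply: smooth_partial.
Qed.

Lemma partial_eq0 f i x : ~ supp f x -> partial i f x = 0.
Proof.
move=> fx; have oU : open (~` supp f) by exact/closed_openC/closed_closure.
rewrite /partial (@near_eq_derive _ _ _ f (cst 0)) ?derive_cst//.
have : nbhs x (~` supp f) by exact: open_nbhs_nbhs.
apply: filterS => y fy /=; apply: contrapT => /eqP fy0; apply: fy.
exact: subset_closure.
Qed.

Lemma supp_partial f i : supp (partial i f) `<=` supp f.
Proof.
have /closure_id -> : closed (supp f) by exact: closed_closure.
apply: closure_subset => x /= /eqP fx; apply: contrapT => /partial_eq0 h.
by apply: fx; rewrite h.
Qed.

Lemma supp_eq0 f x : ~ supp f x -> f x = 0.
Proof.
move=> fx; apply: contrapT => /eqP fx0; apply: fx; exact: subset_closure.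
Qed.

Lemma laplacian_eq0 f x : ~ supp f x -> laplacian f x = 0.
Proof.
move=> fx; rewrite /laplacian big1// => i _; apply: partial_eq0 => /supp_partial.
exact: fx.
Qed.

Lemma compact_box (K : set 'rV[R]_N) : compact K ->
  exists M, forall x i, M < `|x ord0 i| -> ~ K x.
Proof.
move=> /compact_bounded[M [Mreal KM]]; exists (M + 1) => x i Mx Kx.
have /KM /(_ x Kx) xM : M < M + 1 by rewrite ltrDl.
move: Mx; rewrite ltNge => /negP; apply; apply: le_trans xM.
rewrite [leRHS]/Num.Def.normr/= mx_normrE.
by apply/bigmax_geP; right => /=; exists (ord0, i).
Qed.

(** Together with [compact_box], this supplies the hypotheses of
[bounded_integrable_row] and [integral_partial0]. *)
Lemma compact_supp_bounded (K : set 'rV[R]_N) f : compact K -> continuous f ->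
  (forall x, ~ K x -> f x = 0) -> exists B, forall x, `|f x| <= B.
Proof.
move=> cK cf fK.
have /compact_bounded[M [Mreal KM]] : compact (f @` K).
  by apply: continuous_compact => //; exact: continuous_subspaceT.
exists (`|M| + 1) => x; have [Kx|/fK ->] := pselect (K x); last first.
  by rewrite normr0 addr_ge0.
by apply: KM; [rewrite (le_lt_trans (ler_norm _))// ltrDl|exists x].
Qed.

End smooth_functions.

(** * The weighted Rellich inequality *)

Section weighted_rellich.
Variables (R : realType) (N : nat).
Implicit Types (x : 'rV[R]_N).

Definition sqnorm x : R := \sum_i x ord0 i ^+ 2.

Lemma sqnorm_ge0 x : 0 <= sqnorm x.
Proof. by apply: sumr_ge0 => i _; exact: sqr_ge0. Qed.

Lemma coord_row_continuous (i : 'I_N) : continuous (fun x => x ord0 i).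
Proof. exact: coord_continuous. Qed.

Lemma sqnorm_continuous : continuous sqnorm.
Proof.
by apply: continuous_bigsum => i; apply: continuous_exp; exact: coord_row_continuous.
Qed.

Lemma is_derive_sqnorm x i (t : R) :
  is_derive t 1 (fun s => sqnorm (x + s *: delta_mx ord0 i))
    (2 * (x + t *: delta_mx ord0 i) ord0 i).
Proof.
have E : (fun s : R => sqnorm (x + s *: delta_mx ord0 i)) =
    (fun s => sqnorm x - x ord0 i ^+ 2) + (fun s => (x ord0 i + s)) * (fun s => (x ord0 i + s)).
  apply/funext => s; rewrite !fctE /sqnorm [in LHS](bigD1 i)//= [in RHS](bigD1 i)//=.
  rewrite !mxE !eqxx mulr1 [X in _ + X = _](eq_bigr (fun j => x ord0 j ^+ 2)).
    by ring.
  by move=> j ji; rewrite !mxE (negbTE ji) andbF mulr0 addr0.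
rewrite E.
have dxs : is_derive t 1 (fun s => x ord0 i + s) (0 + 1).
  exact: (is_deriveD (is_derive_cst _ _ _) (is_derive_id _ _)).
apply: (is_derive_eq (is_deriveD (is_derive_cst _ _ _) (is_deriveM dxs dxs))).
rewrite !mxE !eqxx /GRing.scale/=.
by ring.
Qed.

(** The divergence of the test field integrates to zero, so its pointwise lower
bound becomes an inequality between integrals.  Any nondecreasing profile [m]
with values in [1, 2] is allowed, so [m1] can be concentrated where needed. *)
Lemma weighted_rellich (phi : 'rV[R]_N -> R) (m m1 : R -> R) (e : R) :
  (5 <= N)%N -> smooth phi -> compact (supp phi) -> 0 < e ->
  continuous m1 -> (forall s : R, is_derive s 1 m (m1 s)) ->
  (forall s, 1 <= m s <= 2) -> (forall s, 0 <= m1 s) ->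
  (\int[row_measure (@lebesgue_measure R) N]_x
     (phi x ^+ 2 * sqnorm x * m1 (Num.sqrt (sqnorm x + e)) /
       (Num.sqrt (sqnorm x + e) * (sqnorm x + e) ^+ 2))%:E <=
   4^-1%:E * \int[row_measure (@lebesgue_measure R) N]_x (laplacian phi x ^+ 2)%:E)%E.
Proof.
move=> N5 sphi csupp e0 cm1 dm m12 m10.
pose r x := sqnorm x + e.
have r0 x : 0 < r x by apply: ltr_wpDl => //; exact: sqnorm_ge0.
have sr0 x : 0 < Num.sqrt (r x) by rewrite sqrtr_gt0.
have cr : continuous r.
  apply: (@continuous_add _ _ sqnorm (fun=> e)); first exact: sqnorm_continuous.
  exact: cst_continuous.
have csr : continuous (fun x => Num.sqrt (r x)) by exact: continuous_sqrt.
have cm : continuous m.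
  move=> t; apply: differentiable_continuous; apply/derivable1_diffP.
  by have [] := dm t.
have cmr (k : R -> R) : continuous k -> continuous (fun x => k (Num.sqrt (r x))).
  move=> ck x; apply: (@continuous_comp _ _ _ (fun x => Num.sqrt (r x)) k).
    exact: csr.
  exact: ck.
have cri k : continuous (fun x => (r x ^+ k)^-1).
  apply: continuous_inv; last exact: continuous_exp.
  by move=> x; rewrite gt_eqF// exprn_gt0.
pose H i x := phi x * partial i phi x / r x +
  phi x ^+ 2 * x ord0 i * m (Num.sqrt (r x)) / r x ^+ 2.
pose D i x := (partial i phi x) ^+ 2 / r x + phi x * partial i (partial i phi) x / r x
     + 2 * phi x * partial i phi x * x ord0 i * (m (Num.sqrt (r x)) - 1) / r x ^+ 2
     + phi x ^+ 2 * m (Num.sqrt (r x)) / r x ^+ 2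
     + phi x ^+ 2 * x ord0 i ^+ 2 * m1 (Num.sqrt (r x)) / (Num.sqrt (r x) * r x ^+ 2)
     - 4 * phi x ^+ 2 * x ord0 i ^+ 2 * m (Num.sqrt (r x)) / r x ^+ 3.
pose P x := phi x ^+ 2 * sqnorm x * m1 (Num.sqrt (r x)) / (Num.sqrt (r x) * r x ^+ 2).
have P0 x : 0 <= P x.
  apply: divr_ge0; apply: mulr_ge0 => //; last exact: sqr_ge0.
  by apply: mulr_ge0; [exact: sqr_ge0|exact: sqnorm_ge0].
have DP x : P x - 4^-1 * laplacian phi x ^+ 2 <= \sum_i D i x.
  have := @divergence_lower_bound R N (fun i => x ord0 i) (fun i => partial i phi x)
    (phi x) (laplacian phi x) (r x) e (m (Num.sqrt (r x))) (m1 (Num.sqrt (r x)))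
    (Num.sqrt (r x)) N5 e0 (sr0 x) (m12 _) erefl
    (fun i => partial i (partial i phi) x) erefl.
  by rewrite /r addrK.
have cphi := smooth_continuous sphi.
have cp1 i : continuous (partial i phi).
  exact/smooth_continuous/smooth_partial.
have cp2 i : continuous (partial i (partial i phi)).
  exact/smooth_continuous/smooth_partial/smooth_partial.
have clap := laplacian_continuous sphi.
have ccst (c : R) : continuous (fun _ : 'rV[R]_N => c) by exact: cst_continuous.
have cri1 : continuous (fun x => (r x)^-1) by exact: (cri 1%N).
have ccri : continuous (fun x => (Num.sqrt (r x) * r x ^+ 2)^-1).
  apply: continuous_inv; last by apply: continuous_mul => //; exact: continuous_exp.
  by move=> x; rewrite gt_eqF// mulr_gt0// exprn_gt0.
have cD i : continuous (D i).
  have cphi2 := continuous_exp (k := 2) cphi.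
  have cx2 := continuous_exp (k := 2) (@coord_row_continuous i).
  apply: continuous_sub; first (apply: continuous_add; first (apply: continuous_add;
    first (apply: continuous_add; first apply: continuous_add))).
  - by apply: continuous_mul cri1; exact: continuous_exp.
  - by apply: continuous_mul cri1; exact: continuous_mul.
  - apply: continuous_mul (cri _); apply: continuous_mul; last first.
      by apply: continuous_sub (ccst 1); exact: cmr.
    apply: continuous_mul (@coord_row_continuous i).
    by apply: continuous_mul (cp1 i); exact: continuous_mul.
  - by apply: continuous_mul (cri _); apply: continuous_mul cphi2 _; exact: cmr.
  - apply: continuous_mul ccri; apply: continuous_mul (cmr _ cm1).
    exact: continuous_mul.
  - apply: continuous_mul (cri _); apply: continuous_mul (cmr _ cm).
    by apply: continuous_mul cx2; exact: continuous_mul.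
have cP : continuous P.
  apply: continuous_mul ccri; apply: continuous_mul (cmr _ cm1).
  by apply: continuous_mul sqnorm_continuous; exact: continuous_exp.
have cl2 : continuous (fun x => laplacian phi x ^+ 2) by exact: continuous_exp.
have [M MP] := compact_box csupp.
have out x i : M < `|x ord0 i| -> ~ supp phi x by exact: MP.
have D_out i x : ~ supp phi x -> D i x = 0.
  move=> sx; have sx' : ~ supp (partial i phi) x by move/supp_partial.
  rewrite /D (supp_eq0 sx) (partial_eq0 i sx) (partial_eq0 i sx').
  by rewrite expr0n/= !(mulr0,mul0r,addr0,subr0).
have P_out x : ~ supp phi x -> P x = 0.
  by move=> sx; rewrite /P (supp_eq0 sx) expr0n/= !mul0r.
have l_out x : ~ supp phi x -> laplacian phi x ^+ 2 = 0.
  by move=> sx; rewrite (laplacian_eq0 sx) expr0n.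
have integ (f : 'rV[R]_N -> R) : continuous f -> (forall x, ~ supp phi x -> f x = 0) ->
    (row_measure (@lebesgue_measure R) N).-integrable setT (EFin \o f).
  move=> cf f_out; have [B fB] := compact_supp_bounded csupp cf f_out.
  by apply: (@bounded_integrable_row R N f M B) => // x i xi; apply: f_out; exact: out xi.
have iD i := integ _ (cD i) (D_out i).
have il := integ _ cl2 l_out.
have D0 i : (\int[row_measure (@lebesgue_measure R) N]_x (D i x)%:E = 0)%E.
  have [B fB] := compact_supp_bounded csupp (cD i) (D_out i).
  apply: (@integral_partial0 R N i (H i) (D i) M B) => //.
    move=> x t.
    apply: (@is_derive_field R (fun s => phi (x + s *: delta_mx ord0 i))
      (fun s => partial i phi (x + s *: delta_mx ord0 i))
      (fun s => (x + s *: delta_mx ord0 i) ord0 i)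
      (fun s => r (x + s *: delta_mx ord0 i)) m t).
    - exact: r0.
    - exact: smooth_is_derive.
    - exact/smooth_is_derive/smooth_partial.
    - rewrite (_ : (fun s => _) = cst (x ord0 i) + id); last first.
        by apply/funext => s; rewrite !fctE !mxE !eqxx mulr1.
      by rewrite -[X in is_derive _ _ _ X]add0r; exact: is_deriveD.
    - rewrite -[X in is_derive _ _ _ X]addr0.
      exact: (is_deriveD (is_derive_sqnorm _ _ _) (is_derive_cst _ _ _)).
  move=> x j /out sx; split; last exact: D_out.
  by rewrite /H (supp_eq0 sx) expr0n/= !(mul0r, addr0).
have iS : (row_measure (@lebesgue_measure R) N).-integrable setT
    (fun x => \sum_i (D i x)%:E)%E.
  by apply: integrable_sum => [|i _]; [exact: measurableT|exact: iD].
have il4 : (row_measure (@lebesgue_measure R) N).-integrable setT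
    (fun x => 4^-1%:E * (laplacian phi x ^+ 2)%:E)%E.
  by apply: integrableZl => //; exact: measurableT.
apply: (@le_trans _ _ (\int[row_measure (@lebesgue_measure R) N]_x
    ((\sum_i (D i x)%:E) + (4^-1%:E * (laplacian phi x ^+ 2)%:E)))%E).
  apply: le_integral => //.
  - exact: (integ P).
  - by apply: integrableD => //; exact: measurableT.
  - move=> x _; rewrite sumEFin -EFinM -EFinD lee_fin -lerBlDr.
    exact: DP.
rewrite integralD//=.
rewrite integral_sum//= big1 ?add0e; last by move=> i _; exact: D0.
by rewrite integralZl.
Qed.

End weighted_rellich.

(** * Integrals and outer measures *)

Section lebesgue_row.
Variables (R : realType) (n : nat).
Local Notation rowm := (row_measure (@lebesgue_measure R) n).

Lemma borel_lebesgue_row (A : set 'rV[measurableTypeR R]_n) :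
  measurable A -> measurable (A : set (lebesgue_rowType R n)).
Proof. exact: caratheodory_measurable_mu_ext. Qed.

Lemma measurable_id_lebesgue_row :
  measurable_fun [set: lebesgue_rowType R n]
    (id : lebesgue_rowType R n -> 'rV[measurableTypeR R]_n).
Proof. by move=> _ A mA; rewrite setTI; exact: borel_lebesgue_row. Qed.

Lemma measurable_borel_lebesgue_row d (U : measurableType d)
    (f : 'rV[measurableTypeR R]_n -> U) :
  measurable_fun setT f -> measurable_fun [set: lebesgue_rowType R n] f.
Proof. by move=> mf; exact: (measurableT_comp mf measurable_id_lebesgue_row). Qed.

(** The Borel measure [row_measure] is the image of its completion under the
identity; this moves computations with Borel functions to the Borel side, where
Fubini's theorem is available. *)
Lemma ge0_integral_lebesgue_row (f : 'rV[measurableTypeR R]_n -> \bar R) :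
  measurable_fun setT f -> (forall x, 0 <= f x)%E ->
  (\int[lebesgue_row R n]_x f x = \int[rowm]_x f x)%E.
Proof.
move=> mf f0.
have := @ge0_integral_pushforward _ _ (lebesgue_rowType R n) 'rV[measurableTypeR R]_n R _
  measurable_id_lebesgue_row (lebesgue_row R n) setT f measurableT mf (fun y _ => f0 y).
move=> /esym h; apply: (eq_trans h).
unshelve refine (@eq_measure_integral _ 'rV[measurableTypeR R]_n R setT rowm _ f _).
  exact: measurable_id_lebesgue_row.
move=> A mA _.
exact: (@measurable_mu_extE _ R _ rowm A mA).
Qed.

End lebesgue_row.

Lemma ge0_integral_le_scale d (T : measurableType d) (R : realType)
    (mu : {measure set T -> \bar R}) (D : set T) (k P : T -> R) (c : R) :
  measurable D -> measurable_fun setT (EFin \o k) -> measurable_fun setT (EFin \o P) ->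
  0 <= c -> (forall x, 0 <= k x) -> (forall x, 0 <= P x) ->
  (forall x, D x -> k x <= c * P x) ->
  (\int[mu]_(x in D) (k x)%:E <= c%:E * \int[mu]_x (P x)%:E)%E.
Proof.
move=> mD mk mP c0 k0 P0 kP.
apply: (@le_trans _ _ (\int[mu]_(x in D) (c%:E * (P x)%:E))%E).
  apply: ge0_le_integral => //.
  - by move=> x _; rewrite lee_fin.
  - exact: measurable_funTS.
  - by apply: measurable_funTS; exact: measurable_funeM.
rewrite ge0_integralZl//.
- apply: lee_wpmul2l; first by rewrite lee_fin.
  by apply: ge0_subset_integral => // x _; rewrite lee_fin.
- exact: measurable_funTS.
- by move=> x _; rewrite lee_fin.
Qed.

Lemma ge0_integral_bigcup_le d (T : measurableType d) (R : realType)
    (mu : {measure set T -> \bar R}) (F : (set T)^nat) (f : T -> \bar R) :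
  (forall k, measurable (F k)) -> measurable_fun setT f -> (forall x, 0 <= f x)%E ->
  (\int[mu]_(x in \bigcup_k F k) f x <= \sum_(k <oo) \int[mu]_(x in F k) f x)%E.
Proof.
move=> mF mf f0.
have mD k : measurable (seqDU F k).
  by apply: measurableD => //; exact: bigsetU_measurable.
rewrite seqDU_bigcup_eq ge0_integral_bigcup//; last first.
  exact: measurable_funTS.
apply: lee_nneseries => [*|k _]; first exact: integral_ge0.
apply: ge0_subset_integral => //; first exact: measurable_funTS.
exact: subDsetl.
Qed.

(** A bound on the slabs a < rad <= b extends to arbitrary sets of values of
[rad], because the completed Lebesgue measure is an infimum over countable covers
by such intervals.  The set [A] is only compared with [M], not pulled back: the
preimage under [rad] of a Lebesgue measurable set may fail to be measurable. *)
Lemma integral_le_outer_measure d (T : measurableType d) (R : realType)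
    (mu : {measure set T -> \bar R}) (rad : T -> R) (k : T -> \bar R)
    (D M : set T) (A : set R) (C : R) :
  0 < C -> measurable D -> measurable M -> M `<=` D ->
  measurable_fun setT rad -> measurable_fun setT k -> (forall x, 0 <= k x)%E ->
  (forall a b : R, a < b ->
    (\int[mu]_(x in D `&` [set x | a < rad x <= b]%R) k x <= (C * (b - a))%:E)%E) ->
  (forall x, M x -> A (rad x)) ->
  (\int[mu]_(x in M) k x <= C%:E * @completed_lebesgue_measure R A)%E.
Proof.
move=> C0 mD mM MD mrad mk k0 shell MA.
rewrite -lee_pdivrMl//.
apply: le_ereal_inf_tmp => _ [F [mF AF] <-].
rewrite lee_pdivrMl//.
pose S j := D `&` rad @^-1` (F j).
have mS j : measurable (S j).
  apply: measurableI => //; rewrite -[X in measurable X]setTI; apply: mrad => //.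
  by have [[a b] _ <-] := mF j; exact: measurable_itv.
apply: (@le_trans _ _ (\int[mu]_(x in \bigcup_j S j) k x)%E).
  apply: ge0_subset_integral => //; first exact: bigcup_measurable.
    exact: measurable_funTS.
  by move=> x Mx; have [j _ Fj] := AF _ (MA _ Mx); exists j => //; split => //; exact: MD.
apply: le_trans (ge0_integral_bigcup_le _ _ _ _) _ => //.
rewrite -nneseriesZl; last by move=> j _; exact: wlength_ge0.
apply: lee_nneseries => [*|j _]; first exact: integral_ge0.
have [[a b] _ Fab] := mF j.
rewrite /S -Fab/= wlength_itv/= lte_fin; case: ifPn => ab.
  rewrite -EFinB -EFinM; apply: le_trans (shell a b ab).
  apply: ge0_subset_integral => //.
  - by move: (mS j); rewrite /S -Fab.
  - apply: measurableI => //; rewrite -[X in measurable X]setTI.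
    have := mrad measurableT _ (measurable_itv `]a, b]).
    by congr measurable; apply/seteqP; split => x /=; rewrite in_itv.
  - exact: measurable_funTS.
rewrite mule0 (_ : _ `&` _ = set0) ?integral_set0//.
apply/seteqP; split => x //= [_]; rewrite in_itv/= => /andP[ax xb].
by move: ab; rewrite (lt_le_trans ax xb).
Qed.

(** * Spherical shells *)

Section shell.
Variables (R : realType) (N : nat).
Implicit Types (x : 'rV[R]_N).

Lemma enorm_continuous : continuous (@enorm R N).
Proof. exact: continuous_sqrt (@sqnorm_continuous R N). Qed.

Lemma enorm_ge0 x : 0 <= enorm x.
Proof. exact: sqrtr_ge0. Qed.

Lemma sqr_enorm x : enorm x ^+ 2 = sqnorm x.
Proof. by rewrite sqr_sqrtr// sqnorm_ge0. Qed.

(** The profile used for the shell that starts at [a] and has thickness [h]: a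
step from 1 to 2 whose derivative is of order 1 / h on the shell. *)
Lemma is_derive_arctan_step (a h s : R) : 0 < h ->
  is_derive s 1 (fun s => 3 / 2 + atan ((s - a) / h) / pi)
    (pi * h * (1 + ((s - a) / h) ^+ 2))^-1.
Proof.
move=> h0.
have p0 := @pi_gt0 R.
have daff : is_derive s 1 (fun s => (s - a) / h) h^-1.
  rewrite (_ : (fun s => _) = h^-1 *: (id - cst a)).
    apply: (is_derive_eq (is_deriveZ _ (is_deriveB (is_derive_id _ _) (is_derive_cst _ _ _)))).
    by rewrite /GRing.scale/= subr0 mulr1.
  by apply/funext => t; rewrite !fctE /GRing.scale/= mulrC.
have dat := @is_derive1_comp _ _ (fun s => (s - a) / h) s _ _ (is_derive1_atan _) daff.
rewrite (_ : (fun s => _) = cst (3 / 2) + pi^-1 *: (@atan R \o (fun s => (s - a) / h))).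
  apply: (is_derive_eq (is_deriveD (is_derive_cst _ _ _) (is_deriveZ _ dat))).
  rewrite /GRing.scale/= add0r -!invfM; congr (_^-1); ring.
by apply/funext => t; rewrite !fctE /GRing.scale/= [_^-1 * _]mulrC.
Qed.

Lemma arctan_step_bounds (a h s : R) : 1 <= 3 / 2 + atan ((s - a) / h) / pi <= 2.
Proof.
have p0 := @pi_gt0 R.
have := atan_gtNpi2 ((s - a) / h); have := atan_ltpi2 ((s - a) / h).
set t := atan _ => t1 t2.
have t1' : t / pi <= 2^-1 by rewrite ler_pdivrMr//; lra.
have t2' : - 2^-1 <= t / pi by rewrite ler_pdivlMr//; lra.
by apply/andP; split; lra.
Qed.

(** Equal to phi^2 |x|^-3 when [delta <= |x|]; the maximum makes it continuous on
the whole space. *)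
Definition radial_weight (delta : R) (phi : 'rV[R]_N -> R) x : R :=
  phi x ^+ 2 / Num.max delta (enorm x) ^+ 3.

Lemma radial_weight_ge0 delta phi x : 0 < delta -> 0 <= radial_weight delta phi x.
Proof.
by move=> d0; rewrite divr_ge0 ?sqr_ge0// exprn_ge0// le_max ltW.
Qed.

Lemma radial_weight_continuous delta phi : 0 < delta -> continuous phi ->
  continuous (radial_weight delta phi).
Proof.
move=> d0 cphi; apply: continuous_mul; first exact: continuous_exp.
apply: continuous_inv.
  by move=> x; rewrite gt_eqF// exprn_gt0// lt_max d0.
apply: continuous_exp => x; apply: continuous_max; first exact: cst_continuous.
exact: enorm_continuous.
Qed.

(** With [s] the square root of n^2 + e, the assumptions give n <= s <= n + h and
s^2 <= 2 n^2, hence (s - a) / h lies in [0, 2], so that the derivative of the step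
is at least 1 / (5 pi h), while s^5 <= 8 n^5; whence the factor 40. *)
Lemma shell_pointwise (a h delta e n f2 : R) : 0 < delta -> 0 < h -> 0 < e ->
  e <= delta ^+ 2 -> e <= delta * h -> delta <= n -> a < n <= a + h -> 0 <= f2 ->
  f2 / n ^+ 3 <= 40 * pi * h *
    (f2 * n ^+ 2 * (pi * h * (1 + ((Num.sqrt (n ^+ 2 + e) - a) / h) ^+ 2))^-1 /
      (Num.sqrt (n ^+ 2 + e) * (n ^+ 2 + e) ^+ 2)).
Proof.
move=> d0 h0 e0 ed eh dn /andP[an nb] f20.
have := @pi_gt0 R; move: (@pi R) => p p0.
have n0 : 0 < n by lra.
have rho0 : 0 < n ^+ 2 + e by rewrite addr_gt0// exprn_gt0.
set s := Num.sqrt _.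
have s0 : 0 < s by rewrite sqrtr_gt0.
have s2 : n ^+ 2 + e = s ^+ 2 by rewrite sqr_sqrtr// ltW.
have nn : n \in Num.nneg by rewrite nnegrE ltW.
have sn : s \in Num.nneg by rewrite nnegrE ltW.
have dnn : delta \in Num.nneg by rewrite nnegrE ltW.
have nhn : n + h \in Num.nneg by rewrite nnegrE; lra.
have n2n : 2 * n \in Num.nneg by rewrite nnegrE; lra.
have dn2 : delta ^+ 2 <= n ^+ 2 by rewrite ler_pXn2r.
have ns : n <= s by rewrite -(@ler_pXn2r _ 2)// -s2 lerDl ltW.
have snh : s <= n + h.
  rewrite -(@ler_pXn2r _ 2)// -s2 sqrrD.
  have : delta * h <= n * h by rewrite ler_wpM2r// ltW.
  have := sqr_ge0 h; have : 0 < n * h by rewrite mulr_gt0.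
  by lra.
have s2n : s <= 2 * n.
  rewrite -(@ler_pXn2r _ 2)// -s2 exprMn.
  by have := sqr_ge0 n; lra.
set q := (s - a) / h.
have q1 : 0 <= q by rewrite divr_ge0; lra.
have q2 : q <= 2 by rewrite ler_pdivrMr//; lra.
have q5 : 1 + q ^+ 2 <= 5 by nra.
have q0 : 0 < 1 + q ^+ 2 by rewrite ltr_wpDr ?sqr_ge0.
rewrite s2.
have -> : 40 * p * h * (f2 * n ^+ 2 * (p * h * (1 + q ^+ 2))^-1 / (s * (s ^+ 2) ^+ 2))
   = f2 * (40 * n ^+ 2 / ((1 + q ^+ 2) * s ^+ 5)).
  by field; rewrite !gt_eqF.
rewrite ler_wpM2l//.
rewrite ler_pdivlMr; last by rewrite mulr_gt0// exprn_gt0.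
rewrite mulrC ler_pdivrMr ?exprn_gt0//.
have s5 : s ^+ 5 <= 8 * n ^+ 5.
  have s4 : s ^+ 2 <= 2 * n ^+ 2 by rewrite -s2; lra.
  have -> : s ^+ 5 = s ^+ 2 * (s ^+ 2 * s) by ring.
  have -> : 8 * n ^+ 5 = (2 * n ^+ 2) * ((2 * n ^+ 2) * (2 * n)) by ring.
  by do 2 (apply: ler_pM => //; rewrite ?mulr_ge0 ?sqr_ge0 ?(ltW s0)//).
have -> : 40 * n ^+ 2 * n ^+ 3 = 5 * (8 * n ^+ 5) by ring.
by apply: ler_pM => //; rewrite ?exprn_ge0 ?(ltW q0) ?(ltW s0).
Qed.

End shell.

Section shell_bound.
Variables (R : realType) (N : nat).
Implicit Types (x : 'rV[R]_N).

Lemma measurable_enorm : measurable_fun [set: lebesgue_rowType R N] (@enorm R N).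
Proof.
by apply: measurable_borel_lebesgue_row; apply: continuous_measurable_row; exact: enorm_continuous.
Qed.

Lemma measurable_radial_weight delta (phi : 'rV[R]_N -> R) : 0 < delta -> continuous phi ->
  measurable_fun [set: lebesgue_rowType R N] (fun x => (radial_weight delta phi x)%:E).
Proof.
move=> d0 cphi; apply/measurable_EFinP; apply: measurable_borel_lebesgue_row.
by apply: continuous_measurable_row; exact: radial_weight_continuous.
Qed.

Lemma measurable_exterior (delta : R) :
  measurable ([set x | delta <= enorm x] : set (lebesgue_rowType R N)).
Proof.
have := measurable_enorm measurableT (measurable_itv `[delta, +oo[).
by rewrite setTI; congr measurable; apply/seteqP; split => x /=; rewrite in_itv/= andbT.
Qed.

Lemma measurable_shell (a b : R) :
  measurable ([set x | a < enorm x <= b] : set (lebesgue_rowType R N)).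
Proof.
have := measurable_enorm measurableT (measurable_itv `]a, b]).
by rewrite setTI; congr measurable; apply/seteqP; split => x /=; rewrite in_itv/=.
Qed.

(** The constant is the 40 of [shell_pointwise] times the 1/4 of
[weighted_rellich].  It does not depend on [delta], which only serves to stay off
the singularity of the weight. *)
Lemma shell_bound (phi : 'rV[R]_N -> R) (delta a b : R) :
  (5 <= N)%N -> smooth phi -> compact (supp phi) -> 0 < delta -> a < b ->
  (\int[lebesgue_row R N]_(x in [set x | (delta <= enorm x)%R] `&`
      [set x | (a < enorm x <= b)%R]) (radial_weight delta phi x)%:E
   <= (10 * pi * (b - a))%:E *
      \int[lebesgue_row R N]_x (laplacian phi x ^+ 2)%:E)%E.
Proof.
move=> N5 sphi csupp d0 ab.
pose h := b - a.
have h0 : 0 < h by rewrite subr_gt0.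
(* The first bound on e makes rho comparable to |x|^2 when delta <= |x|, the
   second keeps sqrt rho within h of |x|. *)
pose e := Num.min (delta ^+ 2) (delta * h).
have e0 : 0 < e by rewrite lt_min exprn_gt0// mulr_gt0.
have ed : e <= delta ^+ 2 by rewrite ge_min lexx.
have eh : e <= delta * h by rewrite ge_min lexx orbT.
pose m s : R := 3 / 2 + atan ((s - a) / h) / pi.
pose m1 s : R := (pi * h * (1 + ((s - a) / h) ^+ 2))^-1.
have q0 (s : R) : 0 < pi * h * (1 + ((s - a) / h) ^+ 2).
  by rewrite mulr_gt0 ?mulr_gt0 ?pi_gt0// ltr_wpDr ?sqr_ge0.
have cm1 : continuous m1.
  apply: continuous_inv; first by move=> s; rewrite gt_eqF.
  apply: continuous_mul; first exact: cst_continuous.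
  apply: continuous_add; first exact: cst_continuous.
  apply: continuous_exp; apply: continuous_mul; last exact: cst_continuous.
  by apply: (@continuous_sub _ _ id (fun=> a)); [move=> s; exact: cvg_id|exact: cst_continuous].
have m10 s : 0 <= m1 s by rewrite invr_ge0 ltW.
have wr := @weighted_rellich R N phi m m1 e N5 sphi csupp e0 cm1
  (fun s => is_derive_arctan_step a s h0) (arctan_step_bounds a h) m10.
pose P x := phi x ^+ 2 * sqnorm x * m1 (Num.sqrt (sqnorm x + e)) /
       (Num.sqrt (sqnorm x + e) * (sqnorm x + e) ^+ 2).
have P0 x : 0 <= P x.
  apply: divr_ge0; apply: mulr_ge0 => //; rewrite ?sqr_ge0 ?sqrtr_ge0//.
  by apply: mulr_ge0; [exact: sqr_ge0|exact: sqnorm_ge0].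
have cphi := smooth_continuous sphi.
have csq := @sqnorm_continuous R N.
have cr : continuous (fun x : 'rV[R]_N => sqnorm x + e).
  by apply: continuous_add => //; exact: cst_continuous.
have csr := continuous_sqrt cr.
have cP : continuous P.
  have r0 x : 0 < sqnorm x + e by apply: ltr_wpDl => //; exact: sqnorm_ge0.
  apply: continuous_mul.
    apply: continuous_mul; first by apply: continuous_mul => //; exact: continuous_exp.
    by move=> x; apply: (@continuous_comp _ _ _ (fun x => Num.sqrt (sqnorm x + e)) m1);
      [exact: csr|exact: cm1].
  apply: continuous_inv; last by apply: continuous_mul => //; exact: continuous_exp.
  by move=> x; rewrite gt_eqF// mulr_gt0 ?sqrtr_gt0// exprn_gt0.
have mP : measurable_fun [set: 'rV[measurableTypeR R]_N] (EFin \o P).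
  by apply/measurable_EFinP; exact: continuous_measurable_row.
have ml : measurable_fun [set: 'rV[measurableTypeR R]_N] (fun x => (laplacian phi x ^+ 2)%:E).
  apply/measurable_EFinP; apply: continuous_measurable_row; apply: continuous_exp.
  exact: laplacian_continuous.
have mP' := measurable_borel_lebesgue_row mP.
pose D : set (lebesgue_rowType R N) :=
  [set x | (delta <= enorm x)%R] `&` [set x | (a < enorm x <= b)%R].
have mD : measurable D.
  by apply: measurableI; [exact: measurable_exterior|exact: measurable_shell].
have p0 := @pi_gt0 R.
have c0 : 0 <= 40 * pi * h by rewrite mulr_ge0// ?mulr_ge0// ltW.
rewrite -/D.
apply: (@le_trans _ _ ((40 * pi * h)%:E * \int[lebesgue_row R N]_x (P x)%:E)%E).
  apply: (@ge0_integral_le_scale _ (lebesgue_rowType R N) R (lebesgue_row R N) D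
    (radial_weight delta phi) P _ mD (measurable_radial_weight d0 cphi) mP' c0) => //.
  - by move=> x; exact: radial_weight_ge0.
  - move=> x [/= dx xab]; rewrite /radial_weight max_r//.
    have xah : a < enorm x <= a + h by rewrite /h addrC subrK.
    have := shell_pointwise d0 h0 e0 ed eh dx xah (sqr_ge0 (phi x)).
    by rewrite sqr_enorm.
rewrite (ge0_integral_lebesgue_row mP); last by move=> x; rewrite lee_fin.
rewrite (ge0_integral_lebesgue_row ml); last by move=> x; rewrite lee_fin sqr_ge0.
have -> : (10 * pi * h)%:E = ((40 * pi * h)%:E * 4^-1%:E)%E :> \bar R.
  by rewrite -EFinM; congr EFin; field.
rewrite -muleA; apply: lee_wpmul2l; first by rewrite lee_fin.
exact: wr.
Qed.

End shell_bound.

(** * Layers of a dominated function *)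

Section layers.
Context {R : realType}.
Implicit Types (h t : R).

(** The part of [t] that is seen by [n] layers of thickness [h]. *)
Definition layer_sum h n t : R := \sum_(j < n) h * (j.+1%:R * h < t)%R%:R.

Lemma layer_sum_full h n t : 0 <= h -> n%:R * h < t -> layer_sum h n t = n%:R * h.
Proof.
move=> h0 nt; rewrite /layer_sum (eq_bigr (fun=> h)) ?sumr_const ?card_ord ?mulr_natl// => j _.
by rewrite (le_lt_trans _ nt) ?mulr1// ler_wpM2r// ler_nat.
Qed.

Lemma layer_sumS h n t : 0 <= h -> t <= n.+1%:R * h ->
  layer_sum h n.+1 t = layer_sum h n t.
Proof.
by move=> h0 tn; rewrite /layer_sum big_ord_recr/= ltNge tn mulr0 addr0.
Qed.

Lemma layer_sum_le h n t : 0 <= h -> 0 <= t -> layer_sum h n t <= t.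
Proof.
move=> h0 t0; elim: n => [|n IH]; first by rewrite /layer_sum big_ord0.
have [tn|nt] := leP t (n.+1%:R * h); first by rewrite layer_sumS.
by rewrite layer_sum_full// ltW.
Qed.

Lemma le_layer_sum h n t : 0 <= h -> t <= n.+1%:R * h -> t <= h + layer_sum h n t.
Proof.
move=> h0; elim: n => [|n IH] tn; first by rewrite /layer_sum big_ord0 addr0 -[h]mul1r.
have [tn'|nt] := leP t (n.+1%:R * h); first by rewrite layer_sumS// IH.
by rewrite layer_sum_full//; move: tn; rewrite -[n.+2%:R]natr1 mulrDl mul1r addrC.
Qed.

End layers.

(** The superlevel sets of [G] in [K] are sent by [rad] into those of [f], so the
domination of the measure of density [k] by [nu] bounds the integral of each layer
of [G * k] by the measure of a layer of [f].  Comparing superlevel sets, instead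
of integrating [f \o rad], suits an [f] that is only Lebesgue measurable. *)
Lemma integral_le_layers d1 (T1 : measurableType d1) d2 (T2 : measurableType d2)
    (R : realType) (mu : {measure set T1 -> \bar R}) (nu : {measure set T2 -> \bar R})
    (rad : T1 -> T2) (K : set T1) (E : set T2) (k G : T1 -> R) (f : T2 -> R)
    (C B L : R) :
  measurable K -> measurable E -> measurable_fun setT (EFin \o k) ->
  (forall x, 0 <= k x) -> measurable_fun K G -> measurable_fun E f -> 0 <= C ->
  (forall x, K x -> 0 <= G x <= B) -> (forall x, K x -> E (rad x)) ->
  (forall x, K x -> G x <= f (rad x)) -> (forall t, E t -> 0 <= f t) ->
  (\int[mu]_(x in K) (k x)%:E <= L%:E)%E ->
  (forall M A, measurable M -> M `<=` K -> measurable A -> (forall x, M x -> A (rad x)) ->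
    (\int[mu]_(x in M) (k x)%:E <= C%:E * nu A)%E) ->
  (\int[mu]_(x in K) (G x * k x)%:E <= C%:E * \int[nu]_(t in E) (f t)%:E)%E.
Proof.
move=> mK mE mk k0 mG mf C0 GB KE Gf f0 kL dom.
have L0 : 0 <= L.
  by rewrite -lee_fin; apply: le_trans kL; apply: integral_ge0 => x _; rewrite lee_fin.
apply/lee_addgt0Pr => e e0.
(* Layers of thickness h cost at most h * L, which has to stay below e. *)
pose h := e / (L + 1).
have h0 : 0 < h by rewrite divr_gt0// ltr_wpDl.
have h0' := ltW h0.
have hL : h * L <= e.
  by rewrite /h mulrAC ler_pdivrMr ?ltr_wpDl// ler_pM2l// lerDl.
pose n := Num.truncn (B / h).
have Bn : B <= n.+1%:R * h.
  by rewrite -ler_pdivrMr// ltW// truncnS_gt.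
pose M j := K `&` G @^-1` `]j.+1%:R * h, +oo[.
have mM j : measurable (M j) by apply: mG => //; exact: measurable_itv.
pose A j := E `&` f @^-1` `]j.+1%:R * h, +oo[.
have mA j : measurable (A j) by apply: mf => //; exact: measurable_itv.
have mkK : measurable_fun K (EFin \o k) by exact: measurable_funTS.
have mkM j : measurable_fun K ((EFin \o k) \_ (M j)).
  by apply/(measurable_restrict _ (mM j) mK).1; exact: measurable_funTS.
have kM0 j x : (0 <= ((EFin \o k) \_ (M j)) x)%E.
  by rewrite patchE; case: ifPn => // _; rewrite lee_fin.
apply: (@le_trans _ _ (\int[mu]_(x in K) (h%:E * (k x)%:E +
    \sum_(j < n) h%:E * ((EFin \o k) \_ (M j)) x))%E).
  apply: ge0_le_integral => //.
  - by move=> x Kx; rewrite lee_fin mulr_ge0//; have /andP[] := GB x Kx.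
  - apply/measurable_EFinP; apply: measurable_funM => //.
    by apply/measurable_EFinP.
  - apply: emeasurable_funD; first exact: measurable_funeM.
    by apply: emeasurable_sum => j; exact: measurable_funeM.
  - move=> x Kx.
    rewrite (eq_bigr (fun j : 'I_n => (h * (j.+1%:R * h < G x)%R%:R * k x)%:E)); last first.
      move=> j _; rewrite patchE /=; case: ifPn.
        by rewrite inE => -[_ /=]; rewrite in_itv/= andbT => ->; rewrite mulr1 EFinM.
      rewrite notin_setE => /not_andP[//|/=]; rewrite in_itv/= andbT => /negP/negbTE ->.
      by rewrite mulr0 mul0r mule0.
    rewrite sumEFin -EFinM -EFinD lee_fin -mulr_suml -mulrDl ler_wpM2r//.
    by apply: le_layer_sum => //; apply: le_trans Bn; have /andP[] := GB x Kx.
rewrite ge0_integralD//; last 4 first.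
- by move=> x _; rewrite mule_ge0// lee_fin.
- exact: measurable_funeM.
- by move=> x _; apply: sume_ge0 => j _; rewrite mule_ge0// lee_fin.
- by apply: emeasurable_sum => j; exact: measurable_funeM.
rewrite addeC; apply: leeD; last first.
  rewrite ge0_integralZl//; last by move=> x _; rewrite lee_fin.
  apply: (@le_trans _ _ (h%:E * L%:E)%E).
    by apply: lee_wpmul2l => //; rewrite lee_fin.
  by rewrite -EFinM lee_fin.
rewrite ge0_integral_sum//; last 2 first.
- by move=> j; exact: measurable_funeM.
- by move=> j x _; rewrite mule_ge0// lee_fin.
apply: (@le_trans _ _ (\sum_(j < n) C%:E * (h%:E * nu (A j)))%E).
  apply: lee_sum => j _.
  rewrite ge0_integralZl// muleCA; apply: lee_wpmul2l; first by rewrite lee_fin.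
  rewrite -integral_mkcondr setIidr; last exact: subIsetl.
  apply: dom => //; first exact: subIsetl.
  move=> x [Kx] /=; rewrite in_itv/= andbT => jx; split; first exact: KE.
  by rewrite /= in_itv/= andbT (lt_le_trans jx)// Gf.
rewrite -ge0_sume_distrr; last by move=> j _; rewrite mule_ge0// lee_fin.
apply: lee_wpmul2l; first by rewrite lee_fin.
have mc j : measurable_fun E ((cst 1%E : T2 -> \bar R) \_ (A j)).
  by apply/(measurable_restrict _ (mA j) mE).1; exact: measurable_cst.
have c0 j x : (0 <= ((cst 1%E : T2 -> \bar R) \_ (A j)) x)%E.
  by rewrite patchE; case: ifPn => // _; rewrite lee_fin.
rewrite (eq_bigr (fun j : 'I_n => (\int[nu]_(t in E)
    (h%:E * ((cst 1%E : T2 -> \bar R) \_ (A j)) t))%E)); last first.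
  move=> j _; rewrite ge0_integralZl//; congr (_ * _)%E.
  by rewrite -integral_mkcondr setIidr ?integral_cst ?mul1e//; exact: subIsetl.
rewrite -ge0_integral_sum//; last 2 first.
- by move=> j; exact: measurable_funeM.
- by move=> j x _; rewrite mule_ge0// lee_fin.
apply: ge0_le_integral => //.
- by move=> x _; apply: sume_ge0 => j _; rewrite mule_ge0// lee_fin.
- by apply: emeasurable_sum => j; exact: measurable_funeM.
- exact/measurable_EFinP.
- move=> t Et.
  rewrite (eq_bigr (fun j : 'I_n => (h * (j.+1%:R * h < f t)%R%:R)%:E)); last first.
    move=> j _; rewrite patchE /=; case: ifPn.
      by rewrite inE => -[_ /=]; rewrite in_itv/= andbT => ->; rewrite mulr1 mule1.
    rewrite notin_setE => /not_andP[//|/=]; rewrite in_itv/= andbT => /negP/negbTE ->.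
    by rewrite mulr0 mule0.
  rewrite sumEFin lee_fin; apply: layer_sum_le => //; exact: f0.
Qed.

(** * The inequality for smooth functions *)

Lemma measurable_id_lebesgue_line (R : realType) :
  measurable_fun [set: lebesgue_lineType R]
    (id : lebesgue_lineType R -> measurableTypeR R).
Proof. by move=> _ A mA; rewrite setTI; exact: sub_caratheodory. Qed.

Lemma measurable_weight_r3 (R : realType) (w : R -> R) :
  measurable_fun (`]0, +oo[ : set (lebesgue_lineType R)) w ->
  measurable_fun (`]0, +oo[ : set (lebesgue_lineType R)) (fun r => `|w r| * r ^+ 3).
Proof.
move=> mw; apply: measurable_funM.
  exact: (@measurableT_comp _ _ _ (lebesgue_lineType R) R R (fun x : R => `|x|) _ w _ mw).
apply: measurable_funX; apply: measurable_funTS.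
exact: measurable_id_lebesgue_line.
Qed.

Section radial_domination.
Variables (R : realType) (N : nat).
Implicit Types (x : 'rV[R]_N).

(** The measure of density phi^2 |x|^-3 is dominated, through |x|, by the Lebesgue
measure on the half-line. *)
Lemma radial_weight_dom (phi : 'rV[R]_N -> R) (delta C : R)
    (M : set (lebesgue_rowType R N)) (A : set R) :
  (5 <= N)%N -> smooth phi -> compact (supp phi) -> 0 < delta -> 0 < C ->
  ((10 * pi)%:E * \int[lebesgue_row R N]_x (laplacian phi x ^+ 2)%:E <= C%:E)%E ->
  measurable M -> (forall x, M x -> delta <= enorm x) ->
  (forall x, M x -> A (enorm x)) ->
  (\int[lebesgue_row R N]_(x in M) (radial_weight delta phi x)%:E
   <= C%:E * @completed_lebesgue_measure R A)%E.
Proof.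
move=> N5 sphi csupp d0 C0 EC mM Md MA.
apply: (@integral_le_outer_measure _ (lebesgue_rowType R N) R (lebesgue_row R N)
  (@enorm R N) (EFin \o radial_weight delta phi) [set x | delta <= enorm x] M A C C0
  (measurable_exterior _) mM Md (@measurable_enorm R N)
  (measurable_radial_weight d0 (smooth_continuous sphi))) => //.
  by move=> x; rewrite lee_fin radial_weight_ge0.
move=> a b ab; apply: le_trans (shell_bound N5 sphi csupp d0 ab) _.
rewrite [10 * pi * _]mulrC EFinM -muleA [C * _]mulrC [leRHS]EFinM.
by apply: lee_wpmul2l => //; rewrite lee_fin subr_ge0 ltW.
Qed.

(** Writing g phi^2 = (g |x|^3) (phi^2 |x|^-3) brings this under
[integral_le_layers]: g |x|^3 <= |w| r^3 at r = |x|. *)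
Lemma radial_domination (phi g : 'rV[R]_N -> R) (w : R -> R) (delta r C B : R)
    (K : set (lebesgue_rowType R N)) :
  (5 <= N)%N -> smooth phi -> compact (supp phi) -> 0 < delta -> 0 < r -> 0 < C ->
  ((10 * pi)%:E * \int[lebesgue_row R N]_x (laplacian phi x ^+ 2)%:E <= C%:E)%E ->
  measurable K -> (forall x, K x -> delta <= enorm x <= r) ->
  measurable_fun K g -> (forall x, K x -> 0 <= g x <= B) ->
  measurable_fun (`]0, +oo[ : set (lebesgue_lineType R)) w ->
  (forall x, K x -> g x <= w (enorm x)) ->
  (\int[lebesgue_row R N]_(x in K) (g x * phi x ^+ 2)%:E <=
   C%:E * \int[@completed_lebesgue_measure R]_(t in `]0%R, +oo[) (`|w t| * t ^+ 3)%:E)%E.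
Proof.
move=> N5 sphi csupp d0 r0 C0 EC mK Kd mg gB mw gw.
have K0 x : K x -> 0 < enorm x by move=> /Kd /andP[dx _]; exact: lt_le_trans dx.
have -> : (\int[lebesgue_row R N]_(x in K) (g x * phi x ^+ 2)%:E =
    \int[lebesgue_row R N]_(x in K) (g x * enorm x ^+ 3 * radial_weight delta phi x)%:E)%E.
  apply: eq_integral => x /[!inE] Kx; congr EFin.
  have [dx _] := andP (Kd x Kx).
  rewrite /radial_weight max_r//; field.
  by rewrite gt_eqF// K0.
have mE : measurable (`]0, +oo[%classic : set (lebesgue_lineType R)).
  by apply: sub_caratheodory; exact: measurable_itv.
have mrw := measurable_radial_weight d0 (smooth_continuous sphi).
have rw0 x : 0 <= radial_weight delta phi x by exact: radial_weight_ge0.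
have mG : measurable_fun K (fun x => g x * enorm x ^+ 3).
  have me := @measurable_funTS _ _ (lebesgue_rowType R N) R K _ (@measurable_enorm R N).
  have me3 := @measurable_funX _ (lebesgue_rowType R N) R K _ 3 me.
  exact: (@measurable_funM _ (lebesgue_rowType R N) R K _ _ mg me3).
have GB x : K x -> 0 <= g x * enorm x ^+ 3 <= B * r ^+ 3.
  move=> Kx; have /andP[g0 gb] := gB x Kx; have /andP[_ xr] := Kd x Kx.
  rewrite mulr_ge0 ?exprn_ge0 ?enorm_ge0//= ler_pM// ?exprn_ge0 ?enorm_ge0//.
  by rewrite lerXn2r ?nnegrE ?enorm_ge0// ltW.
have KE x : K x -> (`]0, +oo[%classic : set R) (enorm x).
  by move=> /K0; rewrite /= in_itv/= andbT.
have Gf x : K x -> g x * enorm x ^+ 3 <= `|w (enorm x)| * enorm x ^+ 3.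
  move=> Kx; rewrite ler_wpM2r ?exprn_ge0 ?enorm_ge0//.
  exact: le_trans (gw x Kx) (ler_norm _).
have f0 (t : R) : (`]0, +oo[%classic : set R) t -> 0 <= `|w t| * t ^+ 3.
  by rewrite /= in_itv/= andbT => t0; rewrite mulr_ge0// exprn_ge0// ltW.
pose S : set (lebesgue_rowType R N) := [set x | (delta <= enorm x)%R] `&`
  [set x | (0 < enorm x <= r)%R].
have mS : measurable S.
  by apply: measurableI; [exact: measurable_exterior|exact: measurable_shell].
have KS : K `<=` S by move=> x Kx; have /andP[dx xr] := Kd x Kx; split => //=; rewrite K0.
have kL : (\int[lebesgue_row R N]_(x in K) (radial_weight delta phi x)%:E <= (C * r)%:E)%E.
  have h := @ge0_subset_integral _ (lebesgue_rowType R N) R (lebesgue_row R N) K S mK mS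
      (EFin \o radial_weight delta phi) (measurable_funTS mrw) (fun x _ => rw0 x) KS.
  apply: (le_trans h); apply: (le_trans (shell_bound N5 sphi csupp d0 r0)).
  rewrite subr0 [10 * pi * _]mulrC EFinM -muleA [C * _]mulrC [leRHS]EFinM.
  by apply: lee_wpmul2l => //; rewrite lee_fin ltW.
have dom (M : set (lebesgue_rowType R N)) (A : set (lebesgue_lineType R)) :
    measurable M -> M `<=` K -> measurable A -> (forall x, M x -> A (enorm x)) ->
    (\int[lebesgue_row R N]_(x in M) (radial_weight delta phi x)%:E <=
     C%:E * @completed_lebesgue_measure R A)%E.
  move=> mM MK mA MA.
  by apply: (radial_weight_dom N5 sphi csupp d0 C0 EC mM _ MA) => x /MK /Kd /andP[].
exact: (@integral_le_layers _ (lebesgue_rowType R N) _ (lebesgue_lineType R) R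
  (lebesgue_row R N) (@completed_lebesgue_measure R) (@enorm R N) K `]0, +oo[%classic
  (radial_weight delta phi) (fun x => g x * enorm x ^+ 3) (fun t => `|w t| * t ^+ 3)
  C (B * r ^+ 3) (C * r) mK mE mrw rw0 mG (measurable_weight_r3 mw) (ltW C0) GB KE Gf f0 kL dom).
Qed.

End radial_domination.

(** * Passage to the completion *)

(** The truncation at M makes the square 2M-Lipschitz, which is what L^1
convergence can control. *)
Lemma truncated_sqr_le (R : realType) (M p u : R) : 0 <= M ->
  Num.min `|u| M ^+ 2 <= p ^+ 2 + 2 * M * `|p - u|.
Proof.
move=> M0; set a := Num.min _ _.
have a0 : 0 <= a by rewrite le_min normr_ge0.
have au : a <= `|u| by rewrite ge_min lexx.
have aM : a <= M by rewrite ge_min lexx orbT.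
have pu : `|u| - `|p| <= `|p - u| by rewrite distrC lerB_dist.
have b0 := normr_ge0 p; rewrite -[p ^+ 2]real_normK ?num_real//.
move: (`|p|) (`|p - u|) (normr_ge0 (p - u)) b0 pu => b d d0 b0 pu.
have [ab|ba] := leP a b; nra.
Qed.

(** Lower semicontinuity of the left-hand side along the approximating sequence.
The factor 2 in the constant comes from (a + b)^2 <= 2 a^2 + 2 b^2, which bounds
the energies of the approximants by that of the limit. *)
Lemma integral_truncated_le d (T : measurableType d) (R : realType)
    (mu : {measure set T -> \bar R}) (K Om : set T) (g u Lu : T -> R)
    (p Lp : nat -> T -> R) (M c s : R) :
  measurable K -> measurable Om -> measurable_fun K g -> measurable_fun K u ->
  measurable_fun Om Lu -> (forall k, measurable_fun setT (p k)) ->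
  (forall k, measurable_fun setT (Lp k)) -> 0 <= M ->
  (forall x, K x -> 0 <= g x <= M) -> 0 < c -> 0 <= s ->
  (forall k C, 0 < C -> (c%:E * \int[mu]_(x in Om) (Lp k x ^+ 2)%:E <= C%:E)%E ->
    (\int[mu]_(x in K) (g x * p k x ^+ 2)%:E <= (C * s)%:E)%E) ->
  (\int[mu]_(x in Om) ((Lp k x - Lu x) ^+ 2)%:E)%E @[k --> \oo] --> 0%E ->
  (\int[mu]_(x in K) `|p k x - u x|%:E)%E @[k --> \oo] --> 0%E ->
  (\int[mu]_(x in K) (g x * Num.min `|u x| M ^+ 2)%:E <=
   (2 * c * s + 1)%:E * \int[mu]_(x in Om) (Lu x ^+ 2)%:E)%E.
Proof.
move=> mK mOm mg mu_ mLu mp mLp M0 gM c0 s0 hyp cvL cvp.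
set I := (\int[mu]_(x in Om) (Lu x ^+ 2)%:E)%E.
have I0 : (0 <= I)%E by apply: integral_ge0 => x _; rewrite lee_fin sqr_ge0.
have cs0 : 0 <= 2 * c * s by rewrite !mulr_ge0// ltW.
have [->|Ifin] := eqVneq I +oo%E.
  (* The summand 1 in the constant keeps 0 * oo from occurring here. *)
  by rewrite gt0_muley ?leey// lte_fin ltr_wpDl.
have [L LE] : exists L, I = L%:E.
  by exists (fine I); rewrite fineK// ge0_fin_numE// lt_neqAle Ifin leey.
have L0 : 0 <= L by rewrite -lee_fin -LE.
rewrite LE -EFinM.
apply/lee_addgt0Pr => e e0; rewrite -EFinD.
(* D collects everything that the tolerance h is multiplied by below. *)
pose D := 2 * c * s + s + 2 * M ^+ 2 + 1.
have D0 : 0 < D by rewrite ltr_wpDl// !addr_ge0// mulr_ge0// sqr_ge0.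
pose h := e / D.
have h0 : 0 < h by rewrite divr_gt0.
have small (v : nat -> \bar R) : (forall k, 0 <= v k)%E -> v k @[k --> \oo] --> 0%E ->
    \forall k \near \oo, (v k <= h%:E)%E.
  move=> v0 vc.
  have : \forall k \near \oo, (v k < h%:E)%E.
    have /vc : nbhs (0%E : \bar R) [set y | (y < h%:E)%E].
      by apply: open_nbhs_nbhs; split; [exact: open_ereal_lt_ereal|rewrite /= lte_fin].
    by [].
  by apply: filterS => k; exact: ltW.
have [k [pk Lk]] : exists k, (\int[mu]_(x in K) `|p k x - u x|%:E <= h%:E)%E /\
    (\int[mu]_(x in Om) ((Lp k x - Lu x) ^+ 2)%:E <= h%:E)%E.
  have : \forall k \near \oo, (\int[mu]_(x in K) `|p k x - u x|%:E <= h%:E)%E /\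
    (\int[mu]_(x in Om) ((Lp k x - Lu x) ^+ 2)%:E <= h%:E)%E.
    apply: filterS2 (small _ _ cvp) (small _ _ cvL) => [k|k|k].
    - by split.
    - by apply: integral_ge0 => x _; rewrite lee_fin.
    - by apply: integral_ge0 => x _; rewrite lee_fin sqr_ge0.
  by move=> [n _ H]; exists n; exact: (H n (leqnn n)).
have Ek : (\int[mu]_(x in Om) (Lp k x ^+ 2)%:E <= (2 * L + 2 * h)%:E)%E.
  have mLpL : measurable_fun Om (fun x => ((Lp k x - Lu x) ^+ 2)%:E).
    apply/measurable_EFinP; apply: measurable_funX; apply: measurable_funB => //.
    exact: measurable_funTS.
  have mL2 : measurable_fun Om (fun x => (Lu x ^+ 2)%:E).
    by apply/measurable_EFinP; exact: measurable_funX.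
  apply: (@le_trans _ _ (\int[mu]_(x in Om)
    (2%:E * (Lu x ^+ 2)%:E + 2%:E * ((Lp k x - Lu x) ^+ 2)%:E))%E).
    apply: ge0_le_integral => //.
    - by move=> x _; rewrite lee_fin sqr_ge0.
    - by apply/measurable_EFinP; apply: measurable_funX; exact: measurable_funTS.
    - by apply: emeasurable_funD; exact: measurable_funeM.
    - move=> x _; rewrite -!EFinM -EFinD lee_fin.
      have := sqr_ge0 (Lp k x - 2 * Lu x); lra.
  rewrite ge0_integralD//; last 4 first.
  - by move=> x _; rewrite mule_ge0// lee_fin sqr_ge0.
  - exact: measurable_funeM.
  - by move=> x _; rewrite mule_ge0// lee_fin sqr_ge0.
  - exact: measurable_funeM.
  rewrite !ge0_integralZl//; last 2 first.
  - by move=> x _; rewrite lee_fin sqr_ge0.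
  - by move=> x _; rewrite lee_fin sqr_ge0.
  have -> : ((2 * L + 2 * h)%:E = 2%:E * L%:E + 2%:E * h%:E)%E by rewrite -!EFinM -EFinD.
  by apply: leeD; apply: lee_wpmul2l => //; rewrite -/I LE.
pose C := c * (2 * L + 2 * h) + h.
have C0 : 0 < C.
  by rewrite ltr_wpDl// mulr_ge0 ?(ltW c0)// addr_ge0// mulr_ge0// ltW.
have CE : (c%:E * \int[mu]_(x in Om) (Lp k x ^+ 2)%:E <= C%:E)%E.
  apply: (@le_trans _ _ (c%:E * (2 * L + 2 * h)%:E)%E).
    by apply: lee_wpmul2l => //; rewrite lee_fin ltW.
  by rewrite -EFinM lee_fin lerDl ltW.
have main := hyp k C C0 CE.
have mgp : measurable_fun K (fun x => (g x * p k x ^+ 2)%:E).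
  apply/measurable_EFinP; apply: measurable_funM => //; apply: measurable_funX.
  exact: measurable_funTS.
have mpu : measurable_fun K (fun x => `|p k x - u x|%:E).
  apply/measurable_EFinP; apply: measurableT_comp => //; apply: measurable_funB => //.
  exact: measurable_funTS.
have g0 x : K x -> 0 <= g x by move=> /gM /andP[].
apply: (@le_trans _ _ (\int[mu]_(x in K)
  ((g x * p k x ^+ 2)%:E + (2 * M ^+ 2)%:E * `|p k x - u x|%:E))%E).
  apply: ge0_le_integral => //.
  - by move=> x /g0 gx; rewrite lee_fin mulr_ge0// sqr_ge0.
  - apply/measurable_EFinP; apply: measurable_funM => //; apply: measurable_funX.
    apply: measurable_minr => //; exact: measurableT_comp.
  - by apply: emeasurable_funD => //; exact: measurable_funeM.
  - move=> x Kx; have /andP[gx gMx] := gM x Kx.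
    rewrite -EFinM -EFinD lee_fin.
    apply: le_trans (ler_wpM2l gx (truncated_sqr_le (p k x) (u x) M0)) _.
    rewrite mulrDr lerD2l; have := normr_ge0 (p k x - u x).
    have -> : 2 * M ^+ 2 * `|p k x - u x| = M * (2 * M * `|p k x - u x|) by ring.
    by move=> ?; rewrite ler_wpM2r// !mulr_ge0.
rewrite ge0_integralD//; last 3 first.
- by move=> x /g0 gx; rewrite lee_fin mulr_ge0// sqr_ge0.
- by move=> x _; rewrite mule_ge0// lee_fin// mulr_ge0// sqr_ge0.
- exact: measurable_funeM.
rewrite ge0_integralZl//; last by rewrite lee_fin mulr_ge0// sqr_ge0.
apply: (@le_trans _ _ ((C * s)%:E + (2 * M ^+ 2)%:E * h%:E)%E).
  by apply: leeD => //; apply: lee_wpmul2l => //; rewrite lee_fin mulr_ge0// sqr_ge0.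
rewrite -EFinM -EFinD lee_fin.
have hD : h * D = e by rewrite /h divfK// gt_eqF.
rewrite -hD /D /C.
have : 0 <= L + h by rewrite addr_ge0// ltW.
lra.
Qed.

Lemma integral_le_exhaustion d (T : measurableType d) (R : realType)
    (mu : {measure set T -> \bar R}) (D : set T) (K : (set T)^nat) (g u : T -> R) (X : \bar R) :
  measurable D -> (forall n, measurable (K n)) -> nondecreasing_seq K ->
  D = \bigcup_n K n -> measurable_fun D g -> measurable_fun D u ->
  (forall x, D x -> 0 <= g x) ->
  (forall n, (\int[mu]_(x in K n)
     (Num.min (g x) n%:R * Num.min `|u x| n%:R ^+ 2)%:E <= X)%E) ->
  (\int[mu]_(x in D) (g x * u x ^+ 2)%:E <= X)%E.
Proof.
move=> mD mK ndK DK mg mu_ g0 KX.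
have KD n : K n `<=` D by rewrite DK; exact: bigcup_sup.
pose f n x : \bar R := (Num.min (g x) n%:R * Num.min `|u x| n%:R ^+ 2)%:E.
pose F n := f n \_ (K n).
have f0 n x : D x -> (0 <= f n x)%E.
  by move=> Dx; rewrite lee_fin mulr_ge0 ?sqr_ge0// le_min g0/=.
have mf n : measurable_fun D (f n).
  apply/measurable_EFinP; apply: measurable_funM; first exact: measurable_minr.
  apply: measurable_funX; apply: measurable_minr => //; exact: measurableT_comp.
have mF n : measurable_fun D (F n).
  apply/(measurable_restrict _ (mK n) mD).1.
  by apply: measurable_funS (mf n) => //; exact: subIsetl.
have F0 n x : D x -> (0 <= F n x)%E.
  by move=> Dx; rewrite /F patchE; case: ifPn => // _; exact: f0.
have ndF x : D x -> nondecreasing_seq (F ^~ x).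
  move=> Dx m n mn; rewrite /F !patchE; case: ifPn => [|_]; last first.
    by case: ifPn => // _; exact: f0.
  rewrite inE => Kmx; rewrite ifT; last first.
    by rewrite inE; move: (ndK _ _ mn); rewrite subsetEset; exact.
  have mnR : m%:R <= n%:R :> R by rewrite ler_nat.
  have h1 : Num.min (g x) m%:R <= Num.min (g x) n%:R.
    by rewrite le_min !ge_min lexx/= mnR orbT.
  have h2 : Num.min `|u x| m%:R <= Num.min `|u x| n%:R.
    by rewrite le_min !ge_min lexx/= mnR orbT.
  have h3 : 0 <= Num.min `|u x| m%:R by rewrite le_min normr_ge0/=.
  rewrite /f lee_fin ler_pM ?sqr_ge0//; first by rewrite le_min g0/=.
  by rewrite lerXn2r// nnegrE// (le_trans h3 h2).
have Fcvg x : D x -> F n x @[n --> \oo] --> (g x * u x ^+ 2)%:E.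
  move=> Dx; apply: cvg_near_cst.
  have [m _ Kmx] : (\bigcup_n K n) x by rewrite -DK.
  pose p := maxn m (maxn (Num.truncn (g x)).+1 (Num.truncn `|u x|).+1).
  exists p => //= n /= pn; rewrite /F patchE ifT; last first.
    rewrite inE; have : (m <= n)%N by apply: leq_trans pn; exact: leq_maxl.
    by move=> /ndK; rewrite subsetEset; exact.
  have gn : g x <= n%:R.
    apply/ltW/(lt_le_trans (truncnS_gt _)); rewrite ler_nat; apply: leq_trans pn.
    by rewrite /p !leq_max leqnn/= orbT.
  have un : `|u x| <= n%:R.
    apply/ltW/(lt_le_trans (truncnS_gt _)); rewrite ler_nat; apply: leq_trans pn.
    by rewrite /p !leq_max leqnn/= !orbT.
  by rewrite /f !min_l// real_normK ?num_real.
have -> : (\int[mu]_(x in D) (g x * u x ^+ 2)%:E = \int[mu]_(x in D) limn (F ^~ x))%E.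
  by apply: eq_integral => x /[!inE] Dx; apply/esym/cvg_lim => //; exact: Fcvg.
have := @cvg_monotone_convergence _ _ _ mu D mD F mF F0 ndF.
move=> /cvge_to_le; apply; apply: nearW => n.
rewrite /F -integral_mkcondr setIidr//; exact: KX.
Qed.

Section exhaustion.
Variables (R : realType) (N : nat).
Implicit Types (x y : 'rV[R]_N).

(** Compact subsets of Omega that stay away from the origin and from the complement
of Omega.  Both norms are bounded: the sup norm for compactness, the Euclidean one
because it is the radius. *)
Definition exhaustion (Omega : set 'rV[R]_N) (n : nat) : set 'rV[R]_N :=
  [set x | [/\ `|x| <= n.+1%:R, n.+1%:R^-1 <= enorm x, enorm x <= n.+1%:R &
    forall y, ~ Omega y -> n.+1%:R^-1 <= `|x - y|] ].

Lemma exhaustion_closed Omega n : closed (exhaustion Omega n).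
Proof.
rewrite (_ : exhaustion Omega n = [set x | `|x| <= n.+1%:R] `&`
  [set x | n.+1%:R^-1 <= enorm x] `&` [set x | enorm x <= n.+1%:R] `&`
  \bigcap_(y in ~` Omega) [set x | n.+1%:R^-1 <= `|x - y|]); last first.
  by apply/seteqP; split => x /= => [[? ? ? ?]|[[[? ?] ?] ?]].
apply: closedI; first apply: closedI; first apply: closedI.
- apply: (@closed_comp _ _ (fun x : 'rV[R]_N => `|x|) [set t | t <= n.+1%:R]) => [x _|].
    exact: norm_continuous.
  exact: closed_le.
- apply: (@closed_comp _ _ (@enorm R N) [set t | n.+1%:R^-1 <= t]) => [x _|].
    exact: enorm_continuous.
  exact: closed_ge.
- apply: (@closed_comp _ _ (@enorm R N) [set t | t <= n.+1%:R]) => [x _|].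
    exact: enorm_continuous.
  exact: closed_le.
- apply: closed_bigI => y _.
  apply: (@closed_comp _ _ (fun x : 'rV[R]_N => `|x - y|) [set t | n.+1%:R^-1 <= t]) => [x _|].
    apply: (@continuous_comp _ _ _ (fun x => x - y) (fun z => `|z|)); last exact: norm_continuous.
    apply: (@continuousB _ _ _ id (fun=> y)); first exact: cvg_id.
    exact: cst_continuous.
  exact: closed_ge.
Qed.

Lemma exhaustion_measurable Omega n :
  measurable (exhaustion Omega n : set (lebesgue_rowType R N)).
Proof.
by apply: borel_lebesgue_row; apply: closed_measurable_row; exact: exhaustion_closed.
Qed.

Lemma exhaustion_compact Omega n : compact (exhaustion Omega n).
Proof.
apply: bounded_closed_compact; last exact: exhaustion_closed.
exists n.+1%:R; split; first exact: num_real.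
by move=> M nM x [xn _ _ _]; apply: le_trans xn _; exact: ltW.
Qed.

Lemma exhaustion_sub Omega n : exhaustion Omega n `<=` Omega.
Proof.
move=> x [_ _ _ xO]; apply: contrapT => /xO.
by rewrite subrr normr0 leNgt invr_gt0 ltr0n.
Qed.

Lemma exhaustion_nd Omega : nondecreasing_seq (exhaustion Omega).
Proof.
move=> m n mn; rewrite subsetEset => x [x1 x2 x3 x4].
have mn1 : m.+1%:R <= n.+1%:R :> R by rewrite ler_nat.
have mn2 : n.+1%:R^-1 <= m.+1%:R^-1 :> R by rewrite lef_pV2// posrE ltr0n.
split; [exact: le_trans mn1|exact: le_trans x2|exact: le_trans mn1|].
by move=> y Oy; apply: le_trans mn2 _; exact: x4.
Qed.

Lemma enorm_eq0 x : enorm x = 0 -> x = 0.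
Proof.
move=> /eqP; rewrite sqrtr_eq0 => x0.
have /psumr_eq0P h : \sum_i x ord0 i ^+ 2 = 0.
  by apply/eqP; rewrite eq_le x0 sumr_ge0// => i _; exact: sqr_ge0.
apply/rowP => i; rewrite mxE; apply/eqP; rewrite -sqrf_eq0; apply/eqP.
by apply: h => // j _; exact: sqr_ge0.
Qed.

Lemma exhaustion_bigcup (Omega : set 'rV[R]_N) : open Omega ->
  Omega `\` [set 0] = \bigcup_n exhaustion Omega n.
Proof.
move=> oO; apply/seteqP; split => [x [Ox /= x0]|x [n _ xn]]; last first.
  split; first exact: exhaustion_sub xn.
  move=> /= x0; case: xn => _; rewrite x0 /enorm big1 ?sqrtr0.
    by rewrite leNgt invr_gt0 ltr0n.
  by move=> i _; rewrite mxE expr0n.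
have ex0 : 0 < enorm x.
  by rewrite lt_neqAle enorm_ge0 andbT eq_sym; apply/eqP => /enorm_eq0.
have /nbhs_ballP[e /= e0 xe] := oO x Ox.
pose q := Num.max (Num.max `|x| (enorm x)) (Num.max (enorm x)^-1 e^-1).
have qn : q <= (Num.truncn q).+1%:R by rewrite ltW// truncnS_gt.
have n0 : 0 < (Num.truncn q).+1%:R :> R by rewrite ltr0n.
exists (Num.truncn q) => //; split.
- by apply: le_trans qn; rewrite /q !le_max lexx.
- rewrite -[leRHS]invrK lef_pV2 ?posrE ?invr_gt0//.
  by apply: le_trans qn; rewrite /q !le_max lexx !orbT.
- by apply: le_trans qn; rewrite /q !le_max lexx !orbT.
- move=> y Oy; rewrite leNgt; apply/negP => xy; apply: Oy; apply: xe.
  rewrite -ball_normE/=; apply: lt_le_trans xy _.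
  rewrite -[leRHS]invrK lef_pV2 ?posrE ?invr_gt0//.
  by apply: le_trans qn; rewrite /q !le_max lexx !orbT.
Qed.

Lemma closed_origin : closed [set (0 : 'rV[R]_N)].
Proof.
by apply: accessible_closed_set1; apply: hausdorff_accessible; exact: norm_hausdorff.
Qed.

Lemma lebesgue_row_set0 : (0 < N)%N -> lebesgue_row R N [set 0] = 0%E.
Proof.
move=> N0.
have E : [set (0 : 'rV[R]_N)] = [set x | forall i, [set (0 : R)] (x ord0 i)].
  apply/seteqP; split => x /= => [-> i|x0]; first by rewrite mxE.
  by apply/rowP => i; rewrite x0 mxE.
have box := @row_measure_box _ (measurableTypeR R) R (@lebesgue_measure R) N (fun=> [set 0])
  (fun=> measurable_set1 _).
have m0 : measurable ([set 0] : set 'rV[measurableTypeR R]_N).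
  by apply: closed_measurable_row; exact: closed_origin.
transitivity (row_measure (@lebesgue_measure R) N [set 0]).
  exact: measurable_mu_extE.
rewrite {1}E box; case: N N0 => // n _.
rewrite big_ord_recl [X in (X * _)%E](_ : _ = 0%E) ?mul0e//.
exact: lebesgue_measure_set1.
Qed.

End exhaustion.

(** The radii in a member of the exhaustion are bounded away from 0 and infinity,
which is the situation of [radial_domination]; the truncation of g provides the
bound required there. *)
Lemma smooth_hardy_rellich (R : realType) (N : nat) (Omega : set 'rV[R]_N)
    (g : 'rV[R]_N -> R) (w : R -> R) (phi : 'rV[R]_N -> R) (n : nat) (C : R) :
  (5 <= N)%N -> open Omega ->
  measurable_fun (Omega : set (lebesgue_rowType R N)) g ->
  (forall x, Omega x -> 0 <= g x) -> L1_r3 w ->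
  (forall x, Omega x -> x != 0 -> g x <= w (enorm x)) ->
  Cc_infty Omega phi -> 0 < C ->
  ((10 * pi)%:E * \int[lebesgue_row R N]_(x in Omega) (laplacian phi x ^+ 2)%:E <= C%:E)%E ->
  (\int[lebesgue_row R N]_(x in exhaustion Omega n) (Num.min (g x) n%:R * phi x ^+ 2)%:E <=
   C%:E * \int[@completed_lebesgue_measure R]_(t in `]0%R, +oo[) (`|w t| * t ^+ 3)%:E)%E.
Proof.
move=> N5 oO mg g0 [mw wfin] gw [sphi csupp suppO] C0 EC.
have lapE : (\int[lebesgue_row R N]_(x in Omega) (laplacian phi x ^+ 2)%:E =
    \int[lebesgue_row R N]_x (laplacian phi x ^+ 2)%:E)%E.
  rewrite integral_mkcond; apply: eq_integral => x _; rewrite patchE.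
  case: ifPn => //; rewrite notin_setE => Ox.
  by rewrite laplacian_eq0 ?expr0n// => /suppO.
rewrite lapE in EC.
have mK := @exhaustion_measurable R N Omega n.
have mO : measurable (Omega : set (lebesgue_rowType R N)).
  by apply: borel_lebesgue_row; exact: open_measurable_row.
have KO := @exhaustion_sub R N Omega n.
have mgK : measurable_fun (exhaustion Omega n : set (lebesgue_rowType R N)) g.
  exact: (@measurable_funS _ _ (lebesgue_rowType R N) R Omega _ g mO KO mg).
have mgn : measurable_fun (exhaustion Omega n : set (lebesgue_rowType R N))
    (fun x => Num.min (g x) n%:R).
  exact: (@measurable_minr _ (lebesgue_rowType R N) R _ g (fun=> n%:R) mgK (measurable_cst _)).
apply: (@radial_domination R N phi (fun x => Num.min (g x) n%:R) w n.+1%:R^-1 n.+1%:R C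
  n%:R (exhaustion Omega n) N5 sphi csupp _ _ C0 EC mK _ mgn _ mw).
- by rewrite invr_gt0 ltr0n.
- by rewrite ltr0n.
- by move=> x [_ -> ->].
- move=> x /KO Ox; apply/andP; split; last by rewrite ge_min lexx orbT.
  by rewrite le_min g0// ler0n.
- move=> x Kx; rewrite ge_min gw//; first exact: KO.
  apply/eqP => x0; have : (Omega `\` [set 0]) x by rewrite exhaustion_bigcup//; exists n.
  by move=> [_]; exact.
Qed.

Theorem theorem1p3 (R : realType) (N : nat) (Omega : set 'rV[R]_N)
    (g : 'rV[R]_N -> R) :
  (5 <= N)%N ->
  open Omega ->
  measurable_fun (Omega : set (lebesgue_rowType R N)) g ->
  (forall x, Omega x -> 0 <= g x) ->
  (exists2 w : R -> R, L1_r3 w &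
    forall x, Omega x -> x != 0 -> g x <= w (enorm x)) ->
  admissible Omega g.
Proof.
move=> N5 oO mg g0 [w w1 gw].
set I := (\int[@completed_lebesgue_measure R]_(t in `]0%R, +oo[) (`|w t| * t ^+ 3)%:E)%E.
have I0 : (0 <= I)%E.
  apply: integral_ge0 => t /=; rewrite in_itv/= andbT => t0.
  by rewrite lee_fin mulr_ge0// exprn_ge0// ltW.
have [s sE] : exists s, I = s%:E.
  by exists (fine I); rewrite fineK// ge0_fin_numE//; exact: w1.2.
have s0 : 0 <= s by rewrite -lee_fin -sE.
have c0 : 0 < 10 * pi :> R by rewrite mulr_gt0 ?pi_gt0.
(* 10 pi is the constant of [shell_bound], 2 and 1 come from
   [integral_truncated_le]. *)
exists (2 * (10 * pi) * s + 1).
  have c2 : 0 <= 2 * (10 * pi) :> R by apply: mulr_ge0 => //; exact: ltW.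
  by apply: ltr_wpDl => //; exact: mulr_ge0.
move=> u Lu [mu_ mLu [phi [phiC cvL cvu]]].
have mO : measurable (Omega : set (lebesgue_rowType R N)).
  by apply: borel_lebesgue_row; exact: open_measurable_row.
have m0 : measurable ([set 0] : set (lebesgue_rowType R N)).
  by apply: borel_lebesgue_row; apply: closed_measurable_row; exact: closed_origin.
have mK := @exhaustion_measurable R N Omega.
have mgu : measurable_fun (Omega : set (lebesgue_rowType R N)) (fun x => (g x * u x ^+ 2)%:E).
  apply/measurable_EFinP.
  have mu2 := @measurable_funX _ (lebesgue_rowType R N) R Omega _ 2 mu_.
  exact: (@measurable_funM _ (lebesgue_rowType R N) R Omega _ _ mg mu2).
have gu0 x : Omega x -> (0 <= (g x * u x ^+ 2)%:E)%E.
  by move=> Ox; rewrite lee_fin mulr_ge0 ?sqr_ge0// g0.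
have N0 : (0 < N)%N by exact: leq_trans N5.
have := @ge0_negligible_integral _ (lebesgue_rowType R N) R (lebesgue_row R N) Omega [set 0]
  (fun x => (g x * u x ^+ 2)%:E) m0 mO mgu gu0 (lebesgue_row_set0 R N0).
move=> ->.
have sub0 : Omega `\` [set 0] `<=` Omega by move=> x [].
have mD0 : measurable (Omega `\` [set 0] : set (lebesgue_rowType R N)) by exact: measurableD.
have mg' := @measurable_funS _ _ (lebesgue_rowType R N) R Omega _ g mO sub0 mg.
have mu' := @measurable_funS _ _ (lebesgue_rowType R N) R Omega _ u mO sub0 mu_.
apply: (@integral_le_exhaustion _ (lebesgue_rowType R N) R (lebesgue_row R N)
  (Omega `\` [set 0]) (exhaustion Omega) g u _ mD0 mK (@exhaustion_nd R N Omega)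
  (exhaustion_bigcup oO) mg' mu' (fun x Ox => g0 x (sub0 x Ox))) => n.
have KO := @exhaustion_sub R N Omega n.
have mgK := @measurable_funS _ _ (lebesgue_rowType R N) R Omega _ g mO KO mg.
have mgn := @measurable_minr _ (lebesgue_rowType R N) R _ g (fun=> n%:R) mgK (measurable_cst _).
have muK := @measurable_funS _ _ (lebesgue_rowType R N) R Omega _ u mO KO mu_.
have mphi k : measurable_fun [set: lebesgue_rowType R N] (phi k).
  have [sk _ _] := phiC k; apply: measurable_borel_lebesgue_row.
  by apply: continuous_measurable_row; exact: smooth_continuous.
have mlap k : measurable_fun [set: lebesgue_rowType R N] (laplacian (phi k)).
  have [sk _ _] := phiC k; apply: measurable_borel_lebesgue_row.
  by apply: continuous_measurable_row; exact: laplacian_continuous.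
apply: (@integral_truncated_le _ (lebesgue_rowType R N) R (lebesgue_row R N)
  (exhaustion Omega n) Omega (fun x => Num.min (g x) n%:R) u Lu phi
  (fun k => laplacian (phi k)) n%:R (10 * pi) s (mK n) mO mgn muK mLu mphi mlap) => //.
- move=> x /KO Ox; apply/andP; split; last by rewrite ge_min lexx orbT.
  by rewrite le_min g0// ler0n.
- move=> k C C0 EC; rewrite EFinM -sE.
  exact: (smooth_hardy_rellich n N5 oO mg g0 w1 gw (phiC k) C0 EC).
- exact: cvu _ (@exhaustion_compact R N Omega n) KO.
Qed.
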